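(* Let $k$ be a commutative ring and let $A$ be an $A_{[0,\infty[}$-algebra over $k$. Then the morphism of $A_{[0,\infty[}$-algebras $$A\to\Omega BA$$ corresponding to $\mathbf 1_{\Omega BA}$ under the isomorphisms $$\mathsf{Alg}_{[0,2]}(\Omega BA,\Omega BA)\cong\mathsf{CgaCdg}(BA,B\Omega BA)\xleftarrow{\ \sim\ }\mathsf{Alg}_{[0,\infty[}(A,\Omega BA)$$ (the first given by the adjunction $(\Omega,B)$, the second by the full faithfulness of $B$) is universal among the morphisms of $A_{[0,\infty[}$-algebras from $A$ to a curved dg algebra: for every curved dg algebra $A'$, every morphism of $A_{[0,\infty[}$-algebras $A\to A'$ factors through $A\to\Omega BA$ by a unique morphism $\Omega BA\to A'$ of $\mathsf{Alg}_{[0,2]}$.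
   Context: $k$ is a commutative associative unital ring; graded means $\mathbf Z$-graded; $\otimes=\otimes_k$; Koszul sign rule. $(SV)^p=V^{p+1}$; $s:V\to SV$, $w:SV\to V$ are the canonical maps of degrees $-1$, $1$. An $A_{[0,\infty[}$-algebra (curved $A_\infty$-algebra) is a graded module $A$ with maps $m_i:A^{\otimes i}\to A$, $i\ge0$, of degree $2-i$ with $\sum_{j+n+l=p}(-1)^{jn+l}m_{j+1+l}(\mathbf 1^{\otimes j}\otimes m_n\otimes\mathbf 1^{\otimes l})=0$ for all $p\ge0$. A morphism $A\to A'$ is a family $f_i:A^{\otimes i}\to A'$, $i\ge1$, of degree $1-i$ with, for all $p\ge0$, $$\sum_{j+n+l=p}(-1)^{jn+l}f_{j+1+l}(\mathbf 1^{\otimes j}\otimes m_n\otimes\mathbf 1^{\otimes l})=\sum_{1\le r\le p,\ i_1+\dots+i_r=p}(-1)^sm'_r(f_{i_1}\otimes\dots\otimes f_{i_r}),\quad s=\sum_{2\le u\le r}\Big((1-i_u)\sum_{1\le v\le u-1}i_v\Big),$$ the right-hand side being $m'_0$ for $p=0$. Composition: $(f'f)_p=\sum_{1\le r\le p,\ i_1+\dots+i_r=p}(-1)^sf'_r(f_{i_1}\otimes\dots\otimes f_{i_r})$. The category is $\mathsf{Alg}_{[0,\infty[}$. The subcategory $\mathsf{Alg}_{[0,2]}$ has objects the algebras with $m_i=0$ for $i>2$ (curved dg algebras) and morphisms those with $f_i=0$ for $i>1$. $\mathsf{CgaCdg}$: cocomplete graded-augmented counital dg coalgebras $(C,d,\Delta,\varepsilon,\eta)$,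 i.e. $(C,d,\Delta,\eta)$ is a counital dg coalgebra and $(C,\Delta,\varepsilon,\eta)$ is an augmented graded coalgebra ($d\varepsilon\neq0$ allowed) whose reduced coalgebra $\overline C=\mathrm{cok}\,\varepsilon$ is the colimit of the kernels of the iterated comultiplications $\overline C\to\overline C^{\otimes n}$; morphisms respect all structure. $\mathsf{Tw}(C,A)$: degree $1$ maps $\tau:C\to A$ with $\tau\varepsilon=0$ and $m_0\eta+(m_1\tau+\tau d_C)+\sum_{n\ge2}m_n\tau^{\otimes n}\Delta^{(n)}=0$. $BA$ represents $C\mapsto\mathsf{Tw}(C,A)$ on $\mathsf{CgaCdg}$; concretely $BA=T^c(SA)$ with deconcatenation and the unique coderivation whose projection to $k$ vanishes and whose projection to $SA$ has components $-s\,m_i\,w^{\otimes i}$, $i\ge0$. This gives a fully faithful functor $B:\mathsf{Alg}_{[0,\infty[}\to\mathsf{CgaCdg}$; on a morphism $f$, $Bf$ is the unique morphism of augmented counital graded coalgebras whose projection to $SA'$ has components $s\,f_i\,w^{\otimes i}$, $i\ge1$. $\Omega C$ is the curved dg algebra corepresenting $A\mapsto\mathsf{Tw}(C,A)$ on $\mathsf{Alg}_{[0,2]}$, and $\Omega:\mathsf{CgaCdg}\to\mathsf{Alg}_{[0,2]}$ is left adjoint to the restriction of $B$ to $\mathsf{Alg}_{[0,2]}$. *)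

(* Defs.v *)
From HB Require Import structures.
From mathcomp Require Import all_boot all_order all_algebra.
From mathcomp Require Import boolp zify.
Set Implicit Arguments.
Unset Strict Implicit.
Unset Printing Implicit Defensive.
Import Order.TTheory GRing.Theory Num.Theory.
Local Open Scope ring_scope.
Local Open Scope quotient_scope.

Section LinearFacts.
Variable k : comPzRingType.
Implicit Types U V W : lmodType k.

Lemma linD V W (f : V -> W) : linear f -> forall x y, f (x + y) = f x + f y.
Proof. by move=> h x y; rewrite -[x in LHS]scale1r h scale1r. Qed.

Lemma lin0 V W (f : V -> W) : linear f -> f 0 = 0.
Proof.
by move=> h; apply: (@addrI _ (f 0)); rewrite -(linD h) !addr0.
Qed.

Lemma linZ V W (f : V -> W) : linear f -> forall a x, f (a *: x) = a *: f x.
Proof. by move=> h a x; rewrite -[a *: x]addr0 h (lin0 h) addr0. Qed.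

Lemma linN V W (f : V -> W) : linear f -> forall x, f (- x) = - f x.
Proof. by move=> h x; rewrite -scaleN1r (linZ h) scaleN1r. Qed.

Lemma lin_sum V W (f : V -> W) : linear f ->
  forall I (r : seq I) (P : pred I) (F : I -> V),
  f (\sum_(i <- r | P i) F i) = \sum_(i <- r | P i) f (F i).
Proof.
move=> h I r P F; elim/big_rec2: _ => [|i y1 y2 _ <-]; first exact: lin0.
exact: linD.
Qed.

Lemma lin_id V : linear (fun v : V => v). Proof. by []. Qed.

Lemma lin_cst0 V W : linear (fun _ : V => 0 : W).
Proof. by move=> a x y; rewrite scaler0 addr0. Qed.

Lemma lin_comp U V W (f : V -> W) (g : U -> V) :
  linear f -> linear g -> linear (fun x => f (g x)).
Proof. by move=> hf hg a x y; rewrite hg hf. Qed.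

Lemma lin_add V W (f g : V -> W) :
  linear f -> linear g -> linear (fun x => f x + g x).
Proof. by move=> hf hg a x y; rewrite hf hg scalerDr !addrA; congr (_ + _); rewrite addrAC. Qed.

Lemma lin_scale V W (f : V -> W) (b : k) :
  linear f -> linear (fun x => b *: f x).
Proof. by move=> hf a x y; rewrite hf scalerDr !scalerA mulrC. Qed.

Lemma lin_opp V W (f : V -> W) : linear f -> linear (fun x => - f x).
Proof. by move=> hf a x y; rewrite hf opprD scalerN. Qed.

Lemma lin_bigsum V W I (r : seq I) (P : pred I) (F : I -> V -> W) :
  (forall i, P i -> linear (F i)) -> linear (fun x => \sum_(i <- r | P i) F i x).
Proof.
move=> hF a x y; rewrite scaler_sumr -big_split; apply: eq_bigr => i Pi.
exact: hF.
Qed.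

End LinearFacts.

(* The k-module presented by generators X and relators R.  A relator is a     *)
(* formal linear combination of generators; two formal combinations are       *)
(* identified when every map from X to a k-module that kills the relators     *)
(* takes the same value on them.                                              *)
Section Presentation.
Variables (k : comPzRingType) (X : choiceType) (R : seq (k * X) -> Prop).
Implicit Types W : lmodType k.

Definition peval W (f : X -> W) (s : seq (k * X)) : W :=
  \sum_(a <- s) a.1 *: f a.2.

Definition respects W (f : X -> W) := forall r, R r -> peval f r = 0.

Definition peq (s t : seq (k * X)) : bool :=
  `[< forall W (f : X -> W), respects f -> peval f s = peval f t >].

Lemma peq_refl : reflexive peq.
Proof. by move=> s; apply/asboolP. Qed.
Lemma peq_sym : symmetric peq.
Proof.
by move=> s t; apply/asboolP/asboolP => h W f hf; rewrite h.
Qed.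
Lemma peq_trans : transitive peq.
Proof.
move=> s t u /asboolP h1 /asboolP h2; apply/asboolP => W f hf.
by rewrite h1 // h2.
Qed.

Canonical peq_equiv := EquivRel peq peq_refl peq_sym peq_trans.

Definition presmod := {eq_quot peq}.
HB.instance Definition _ := Choice.on presmod.
HB.instance Definition _ := EqQuotient.on presmod.

Definition pgen (x : X) : presmod := \pi_presmod [:: (1, x)].

Definition plift W (f : X -> W) (u : presmod) : W := peval f (repr u).

Lemma plift_pi W (f : X -> W) s : respects f -> plift f (\pi_presmod s) = peval f s.
Proof.
move=> hf; rewrite /plift; have : \pi_presmod (repr (\pi_presmod s)) = \pi_presmod s.
  by rewrite reprK.
by move/eqmodP => /asboolP; apply.
Qed.

Lemma presP (u v : presmod) :
  (forall W (f : X -> W), respects f -> plift f u = plift f v) -> u = v.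
Proof.
move=> h; rewrite -[u]reprK -[v]reprK; apply/eqmodP/asboolP => W f hf.
exact: h.
Qed.

Definition padd (u v : presmod) : presmod := \pi_presmod (repr u ++ repr v).
Definition pzero : presmod := \pi_presmod [::].
Definition pscale (a : k) (u : presmod) : presmod :=
  \pi_presmod [seq (a * b.1, b.2) | b <- repr u].
Definition popp (u : presmod) : presmod := pscale (-1) u.

Lemma plift0 W (f : X -> W) : respects f -> plift f pzero = 0.
Proof. by move=> hf; rewrite plift_pi // /peval big_nil. Qed.
Lemma pliftD W (f : X -> W) u v : respects f ->
  plift f (padd u v) = plift f u + plift f v.
Proof. by move=> hf; rewrite plift_pi // /peval big_cat. Qed.
Lemma pliftZ W (f : X -> W) a u : respects f ->
  plift f (pscale a u) = a *: plift f u.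
Proof.
move=> hf; rewrite plift_pi // /peval big_map /= /plift /peval scaler_sumr.
by apply: eq_bigr => b _; rewrite scalerA.
Qed.
Lemma pliftN W (f : X -> W) u : respects f -> plift f (popp u) = - plift f u.
Proof. by move=> hf; rewrite pliftZ // scaleN1r. Qed.

Lemma paddA : associative padd.
Proof. by move=> u v w; apply: presP => W f hf; rewrite !pliftD // addrA. Qed.
Lemma paddC : commutative padd.
Proof. by move=> u v; apply: presP => W f hf; rewrite !pliftD // addrC. Qed.
Lemma padd0 : left_id pzero padd.
Proof. by move=> u; apply: presP => W f hf; rewrite !pliftD // plift0 // add0r. Qed.
Lemma paddN : left_inverse pzero popp padd.
Proof.
move=> u; apply: presP => W f hf.
by rewrite !pliftD // pliftN // plift0 // addNr.
Qed.
HB.instance Definition _ := GRing.isZmodule.Build presmod paddA paddC padd0 paddN.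

Lemma pscaleA a b u : pscale a (pscale b u) = pscale (a * b) u.
Proof. by apply: presP => W f hf; rewrite !pliftZ // scalerA. Qed.
Lemma pscale1 : left_id 1 pscale.
Proof. by move=> u; apply: presP => W f hf; rewrite pliftZ // scale1r. Qed.
Lemma pscaleDr : right_distributive pscale +%R.
Proof.
move=> a u v; apply: presP => W f hf.
by rewrite !(pliftZ, pliftD) // scalerDr.
Qed.
Lemma pscaleDl u : {morph pscale^~ u : a b / a + b}.
Proof.
move=> a b; apply: presP => W f hf.
by rewrite !(pliftZ, pliftD) // scalerDl.
Qed.
HB.instance Definition _ :=
  GRing.Zmodule_isLmodule.Build k presmod pscaleA pscale1 pscaleDr pscaleDl.

Lemma plift_lin W (f : X -> W) : respects f -> linear (plift f).
Proof. by move=> hf a u v; rewrite pliftD // pliftZ. Qed.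

Lemma plift_gen W (f : X -> W) x : respects f -> plift f (pgen x) = f x.
Proof. by move=> hf; rewrite plift_pi // /peval big_seq1 scale1r. Qed.

Lemma peval_gen s : peval pgen s = \pi_presmod s.
Proof.
apply: presP => W f hf; rewrite plift_pi // /peval (lin_sum (plift_lin hf)).
by apply: eq_bigr => a _; rewrite (linZ (plift_lin hf)) plift_gen.
Qed.

Lemma pgen_respects : respects pgen.
Proof.
move=> r Rr; rewrite peval_gen; apply: presP => W f hf.
by rewrite plift_pi // (lin0 (plift_lin hf)) hf.
Qed.

Lemma pres_ind (P : presmod -> Prop) :
  P 0 -> (forall u v, P u -> P v -> P (u + v)) -> (forall a u, P u -> P (a *: u)) ->
  (forall x, P (pgen x)) -> forall u, P u.
Proof.
move=> P0 PD PZ Pg u; rewrite -[u]reprK -peval_gen /peval.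
elim/big_rec: _ => // a v _ Pv; apply: PD => //; exact: PZ.
Qed.

Lemma pres_ext W (f g : presmod -> W) : linear f -> linear g ->
  (forall x, f (pgen x) = g (pgen x)) -> forall u, f u = g u.
Proof.
move=> hf hg h; apply: pres_ind => [|u v eu ev|a u eu|//].
- by rewrite (lin0 hf) (lin0 hg).
- by rewrite (linD hf) (linD hg) eu ev.
- by rewrite (linZ hf) (linZ hg) eu.
Qed.

End Presentation.

(* A Z-graded module, as a module with its projections onto the homogeneous   *)
(* components (a decomposition of the module as an internal direct sum).      *)
Record grmod (k : comPzRingType) := GrMod {
  gcar :> lmodType k;
  gpr : int -> gcar -> gcar;
  gpr_lin : forall p, linear (gpr p);
  gpr_pr : forall p q v, gpr p (gpr q v) = if p == q then gpr q v else 0;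
  gpr_fin : forall v, exists s : seq int, uniq s && (v == \sum_(p <- s) gpr p v)
}.

Lemma big_uniq_sub (V : zmodType) (s t : seq int) (F : int -> V) :
  uniq s -> uniq t -> {subset s <= t} -> (forall p, p \notin s -> F p = 0) ->
  \sum_(p <- s) F p = \sum_(p <- t) F p.
Proof.
move=> us ut st F0; rewrite [RHS](bigID (mem s)) /= [X in _ + X]big1 ?addr0; last first.
  by move=> p /F0.
rewrite -[RHS]big_filter; apply: perm_big; apply: uniq_perm => //; first exact: filter_uniq.
by move=> p; rewrite mem_filter; case: (boolP (p \in s)) => //= /st ->.
Qed.

Section Graded.
Variable k : comPzRingType.
Implicit Types V W : grmod k.

Definition hom V (p : int) (v : V) : Prop := gpr p v = v.

Definition deg_map V W (d : int) (f : V -> W) : Prop :=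
  forall p v, hom p v -> hom (p + d) (f v).

Definition gdeg V (v : V) : seq int := xchoose (gpr_fin v).

(* the map sending v = sum_p v_p to sum_p h_p (v_p) *)
Definition gsum V (W : lmodType k) (h : int -> V -> W) (v : V) : W :=
  \sum_(p <- gdeg v) h p (gpr p v).

(* The Koszul sign of an operation of degree d moved past an element:         *)
(* v = sum_p v_p is sent to sum_p (-1)^(d p) v_p.                             *)
Definition ksgn V (d : int) : V -> V :=
  gsum (fun p x => (-1) ^+ `|(d * p)%R|%N *: x).

Definition supp V (v : V) (s : seq int) := uniq s /\ v = \sum_(p <- s) gpr p v.

Lemma gdegP V (v : V) : supp v (gdeg v).
Proof. by have /andP[us /eqP e] := xchooseP (gpr_fin v). Qed.

Lemma supp_out V (v : V) s p : supp v s -> p \notin s -> gpr p v = 0.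
Proof.
case=> us e ps; rewrite e (lin_sum (@gpr_lin _ _ _)) big1_seq // => q /andP[_ qs].
by rewrite gpr_pr; case: eqP => // E; rewrite E qs in ps.
Qed.

Lemma supp_sub V (v : V) s t : supp v s -> uniq t -> {subset s <= t} -> supp v t.
Proof.
move=> [us e] ut st; split=> //; rewrite {1}e; apply: big_uniq_sub => // p.
by apply: supp_out.
Qed.

Lemma gsumE V (W : lmodType k) (h : int -> V -> W) v s :
  (forall p, h p 0 = 0) -> supp v s -> gsum h v = \sum_(p <- s) h p (gpr p v).
Proof.
move=> h0 sv; rewrite /gsum; set t := gdeg v.
have st : supp v t by exact: gdegP.
transitivity (\sum_(p <- undup (s ++ t)) h p (gpr p v)).
  apply: big_uniq_sub; rewrite ?undup_uniq //; first by case: st.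
    by move=> p pt; rewrite mem_undup mem_cat pt orbT.
  by move=> p pt; rewrite (supp_out st pt).
symmetry; apply: big_uniq_sub; rewrite ?undup_uniq //; first by case: sv.
  by move=> p pt; rewrite mem_undup mem_cat pt.
by move=> p pt; rewrite (supp_out sv pt).
Qed.

Lemma gsum_lin V (W : lmodType k) (h : int -> V -> W) :
  (forall p, linear (h p)) -> linear (gsum h).
Proof.
move=> hl a x y; have h0 p : h p 0 = 0 by rewrite (lin0 (hl p)).
set s := undup (gdeg x ++ gdeg y ++ gdeg (a *: x + y)).
have us : uniq s by rewrite undup_uniq.
have sx : supp x s.
  by apply: (supp_sub (gdegP x)) => // p pt; rewrite mem_undup !mem_cat pt ?orbT.
have sy : supp y s.
  by apply: (supp_sub (gdegP y)) => // p pt; rewrite mem_undup !mem_cat pt ?orbT.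
have sxy : supp (a *: x + y) s.
  by apply: (supp_sub (gdegP _)) => // p pt; rewrite mem_undup !mem_cat pt ?orbT.
rewrite !(gsumE h0 sx, gsumE h0 sy, gsumE h0 sxy).
rewrite scaler_sumr -big_split; apply: eq_bigr => p _ /=.
by rewrite gpr_lin hl.
Qed.

Lemma supp_hom V p (v : V) : hom p v -> supp v [:: p].
Proof. by move=> hv; split=> //; rewrite big_seq1. Qed.

Lemma gsum_hom V (W : lmodType k) (h : int -> V -> W) p v :
  (forall p, linear (h p)) -> hom p v -> gsum h v = h p v.
Proof.
move=> hl hv; rewrite (gsumE _ (supp_hom hv)) ?big_seq1 ?hv //.
by move=> q; rewrite (lin0 (hl q)).
Qed.

Lemma hom_gpr V p (v : V) : hom p (gpr p v).
Proof. by rewrite /hom gpr_pr eqxx. Qed.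

Lemma gpr_hom V p q (v : V) : hom q v -> gpr p v = if p == q then v else 0.
Proof. by move=> hv; rewrite -{1}hv gpr_pr hv. Qed.

Lemma hom0 V p : hom p (0 : V).
Proof. exact: (lin0 (@gpr_lin _ _ _)). Qed.

Lemma homZ V p a (v : V) : hom p v -> hom p (a *: v).
Proof. by move=> hv; rewrite /hom (linZ (@gpr_lin _ _ _)) hv. Qed.

Lemma homD V p (v w : V) : hom p v -> hom p w -> hom p (v + w).
Proof. by move=> hv hw; rewrite /hom (linD (@gpr_lin _ _ _)) hv hw. Qed.

Lemma homN V p (v : V) : hom p v -> hom p (- v).
Proof. by move=> hv; rewrite -scaleN1r; apply: homZ. Qed.

Lemma hom_sum V p I (r : seq I) (P : pred I) (F : I -> V) :
  (forall i, P i -> hom p (F i)) -> hom p (\sum_(i <- r | P i) F i).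
Proof. by move=> h; elim/big_ind: _ => //; [exact: hom0|apply: homD]. Qed.

Lemma gr_ind V (P : V -> Prop) :
  P 0 -> (forall u v, P u -> P v -> P (u + v)) ->
  (forall p v, hom p v -> P v) -> forall v, P v.
Proof.
move=> P0 PD Ph v; case: (gdegP v) => _ ->; elim/big_ind: _ => // p _.
exact/Ph/hom_gpr.
Qed.

Lemma ksgn_lin V d : linear (@ksgn V d).
Proof. by apply: gsum_lin => p; apply: lin_scale. Qed.

Lemma ksgn_hom V d p (v : V) : hom p v -> ksgn d v = (-1) ^+ `|(d * p)%R|%N *: v.
Proof. by move=> hv; rewrite /ksgn (gsum_hom _ hv) // => q; apply: lin_scale. Qed.

Lemma hom_ksgn V d p (v : V) : hom p v -> hom p (ksgn d v).
Proof. by move=> hv; rewrite (ksgn_hom d hv); apply: homZ. Qed.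

Lemma gr_ext V (W : lmodType k) (f g : V -> W) : linear f -> linear g ->
  (forall p v, hom p v -> f v = g v) -> forall v, f v = g v.
Proof.
move=> hf hg h; apply: gr_ind => [|u v eu ev|//].
  by rewrite (lin0 hf) (lin0 hg).
by rewrite (linD hf) (linD hg) eu ev.
Qed.

Lemma sgn_absz (x : int) : (-1 : k) ^+ `|x|%N = (-1) ^+ odd `|x|%N.
Proof. by rewrite signr_odd. Qed.

Lemma odd_abszD (x y : int) : odd `|(x + y)%R|%N = odd `|x|%N (+) odd `|y|%N.
Proof.
have h (n m : nat) : odd `|(n%:Z - m%:Z)%R|%N = odd n (+) odd m.
  case: (leqP m n) => h.
    by rewrite subzn // absz_nat oddB.
  by rewrite distnC subzn 1?ltnW // absz_nat oddB 1?ltnW // addbC.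
case: x y => [n|n] [m|m].
- by rewrite -PoszD !absz_nat oddD.
- by rewrite NegzE h abszN.
- by rewrite NegzE addrC h abszN addbC.
- by rewrite !NegzE -opprD -PoszD !abszN !absz_nat oddD.
Qed.

Lemma odd_abszM (x y : int) : odd `|(x * y)%R|%N = odd `|x|%N && odd `|y|%N.
Proof. by rewrite abszM oddM. Qed.

Lemma sgnD (x y : int) : (-1 : k) ^+ `|(x + y)%R|%N = (-1) ^+ `|x|%N * (-1) ^+ `|y|%N.
Proof. by rewrite sgn_absz odd_abszD signr_addb !signr_odd. Qed.

Lemma ksgnD V d e (v : V) : ksgn (d + e) v = ksgn d (ksgn e v).
Proof.
move: v; apply: gr_ext => [||p v hv]; first exact: ksgn_lin.
  by apply: lin_comp; apply: ksgn_lin.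
rewrite !(ksgn_hom _ hv) (linZ (@ksgn_lin V d)) (ksgn_hom _ hv) scalerA.
by rewrite mulrDl sgnD mulrC.
Qed.

Lemma ksgn_odd V d e (v : V) : odd `|d|%N = odd `|e|%N -> ksgn d v = ksgn e v.
Proof.
move=> E; move: v; apply: gr_ext => [||p v hv]; try exact: ksgn_lin.
by rewrite !(ksgn_hom _ hv) sgn_absz odd_abszM E -odd_abszM signr_odd.
Qed.

Lemma ksgn0 V (v : V) : ksgn 0 v = v.
Proof.
move: v; apply: gr_ext => [||p v hv]; first exact: ksgn_lin.
  exact: lin_id.
by rewrite (ksgn_hom _ hv) mul0r expr0 scale1r.
Qed.

Lemma ksgn_deg V W d e (f : V -> W) : linear f -> deg_map d f ->
  forall v, ksgn e (f v) = (-1) ^+ `|(e * d)%R|%N *: f (ksgn e v).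
Proof.
move=> hf df; apply: gr_ext => [||p v hv].
- by apply: lin_comp => //; apply: ksgn_lin.
- by apply/lin_scale/lin_comp => //; apply: ksgn_lin.
rewrite (ksgn_hom _ hv) (ksgn_hom _ (df _ _ hv)) (linZ hf) scalerA.
by rewrite mulrDr sgnD mulrC.
Qed.

Lemma deg_map_gpr V W d (f : V -> W) : linear f -> deg_map d f ->
  forall p v, gpr (p + d) (f v) = f (gpr p v).
Proof.
move=> hf df p; apply: gr_ext => [||q v hv].
- by apply: lin_comp => //; apply: gpr_lin.
- by apply: lin_comp => //; apply: gpr_lin.
rewrite (gpr_hom _ (df _ _ hv)) (gpr_hom _ hv) (inj_eq (addIr d)).
by case: eqP => // _; rewrite (lin0 hf).
Qed.

End Graded.

(* (SV)^p = V^(p+1); s : V -> SV and w : SV -> V are the identity of the      *)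
(* underlying module.                                                         *)
Section Suspension.
Variables (k : comPzRingType) (V : grmod k).

Fact susp_pr p q (v : V) :
  gpr (p + 1) (gpr (q + 1) v) = if p == q then gpr (q + 1) v else 0.
Proof. by rewrite gpr_pr (inj_eq (addIr 1)). Qed.

Fact susp_fin (v : V) :
  exists s : seq int, uniq s && (v == \sum_(p <- s) gpr (p + 1) v).
Proof.
have [s /andP[us /eqP e]] := gpr_fin v.
exists [seq p - 1 | p <- s]; rewrite (map_inj_uniq (addIr _)) us /= big_map.
by apply/eqP; rewrite {1}e; apply: eq_bigr => p _; rewrite subrK.
Qed.

Definition susp : grmod k :=
  @GrMod k V (fun p => gpr (p + 1)) (fun p => @gpr_lin k V (p + 1)) susp_pr susp_fin.

Definition sus : V -> susp := fun v => v.
Definition des : susp -> V := fun v => v.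

End Suspension.

Section Unit.
Variable k : comPzRingType.

Let upr (p : int) (v : k^o) : k^o := if p == 0 then v else 0.

Fact gunit_lin p : linear (upr p).
Proof. by rewrite /upr => a x y; case: eqP => // _; rewrite scaler0 addr0. Qed.

Fact gunit_pr p q v : upr p (upr q v) = if p == q then upr q v else 0.
Proof.
rewrite /upr; case: (q =P 0) => [->|_]; first by case: eqP.
by rewrite !if_same.
Qed.

Fact gunit_fin v : exists s : seq int, uniq s && (v == \sum_(p <- s) upr p v).
Proof. by exists [:: 0]; rewrite /= big_seq1 /upr eqxx. Qed.

Definition gunit : grmod k := GrMod gunit_lin gunit_pr gunit_fin.

End Unit.

(* Tensor product of modules. *)
Section Tensor.
Variable k : comPzRingType.
Implicit Types U V W X : lmodType k.

Variant bilin_rel V W : seq (k * (V * W)) -> Prop :=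
| BilinL a v v' w : bilin_rel
    [:: (a, (v, w)); (1, (v', w)); (-1, (a *: v + v', w))]
| BilinR a v w w' : bilin_rel
    [:: (a, (v, w)); (1, (v, w')); (-1, (v, a *: w + w'))].

Definition tensor V W : lmodType k := presmod (@bilin_rel V W).
Definition tens V W (v : V) (w : W) : tensor V W := pgen (@bilin_rel V W) (v, w).

(* the linear map on V (x) W induced by a bilinear map *)
Definition tlift V W X (f : V -> W -> X) : tensor V W -> X :=
  @plift k _ (@bilin_rel V W) X (fun x => f x.1 x.2).

Definition bilin V W X (f : V -> W -> X) :=
  (forall w, linear (f^~ w)) /\ (forall v, linear (f v)).

Lemma bilin_respects V W X (f : V -> W -> X) :
  bilin f <-> respects (@bilin_rel V W) (fun x => f x.1 x.2).
Proof.
split=> [[fl fr] r|h].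
  by case=> [a v v' w|a v w w']; rewrite /peval !big_cons big_nil /= scale1r
    scaleN1r addr0 addrA ?fl ?fr subrr.
split=> [w a v v'|v a w w'].
  have := h _ (BilinL a v v' w); rewrite /peval !big_cons big_nil /= scale1r.
  by rewrite scaleN1r addr0 addrA => /eqP; rewrite subr_eq0 => /eqP.
have := h _ (BilinR a v w w'); rewrite /peval !big_cons big_nil /= scale1r.
by rewrite scaleN1r addr0 addrA => /eqP; rewrite subr_eq0 => /eqP.
Qed.

Lemma tens_bilin V W : bilin (@tens V W).
Proof.
apply/bilin_respects => r Rr; rewrite -[RHS](pgen_respects Rr).
by apply: eq_bigr => -[a [v w]].
Qed.
Lemma tens_linl V W (w : W) : linear (fun v : V => tens v w).
Proof. exact: (tens_bilin V W).1. Qed.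
Lemma tens_linr V W (v : V) : linear (fun w : W => tens v w).
Proof. exact: (tens_bilin V W).2. Qed.

Lemma tlift_lin V W X (f : V -> W -> X) : bilin f -> linear (tlift f).
Proof. by move=> /bilin_respects; apply: plift_lin. Qed.

Lemma tliftE V W X (f : V -> W -> X) v w : bilin f -> tlift f (tens v w) = f v w.
Proof. by move=> /bilin_respects h; rewrite /tlift plift_gen. Qed.

Lemma tens_ext V W X (f g : tensor V W -> X) : linear f -> linear g ->
  (forall v w, f (tens v w) = g (tens v w)) -> forall u, f u = g u.
Proof. by move=> hf hg h; apply: pres_ext => // -[v w]; apply: h. Qed.

Lemma bilin_comp2 U V W X U' (f : U -> V -> X) (g : W -> U) (h : U' -> V) :
  bilin f -> linear g -> linear h -> bilin (fun x y => f (g x) (h y)).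
Proof.
move=> [fl fr] hg hh; split=> [y|x].
  exact: (lin_comp (fl _) hg).
exact: (lin_comp (fr _) hh).
Qed.

Lemma lin_bilin U V W X (f : X -> U) (g : V -> W -> X) :
  linear f -> bilin g -> bilin (fun x y => f (g x y)).
Proof.
move=> hf [gl gr]; split=> [y|x].
  exact: (lin_comp hf (gl _)).
exact: (lin_comp hf (gr _)).
Qed.

(* f (x) g for linear f and g, without Koszul sign *)
Definition tmap U V W X (f : U -> W) (g : V -> X) : tensor U V -> tensor W X :=
  tlift (fun x y => tens (f x) (g y)).

Lemma tmap_bilin U V W X (f : U -> W) (g : V -> X) : linear f -> linear g ->
  bilin (fun x y => tens (f x) (g y)).
Proof. by move=> hf hg; apply: bilin_comp2 => //; apply: tens_bilin. Qed.

Lemma tmap_lin U V W X (f : U -> W) (g : V -> X) : linear f -> linear g ->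
  linear (tmap f g).
Proof. by move=> hf hg; apply/tlift_lin/tmap_bilin. Qed.

Lemma tmapE U V W X (f : U -> W) (g : V -> X) x y : linear f -> linear g ->
  tmap f g (tens x y) = tens (f x) (g y).
Proof. by move=> hf hg; rewrite /tmap tliftE //; apply: tmap_bilin. Qed.

(* (U (x) V) (x) W -> U (x) (V (x) W) *)
Definition tassoc U V W : tensor (tensor U V) W -> tensor U (tensor V W) :=
  tlift (fun t w => tlift (fun u v => tens u (tens v w)) t).

Lemma tassoc_bilin1 U V W (w : W) :
  bilin (fun (u : U) (v : V) => tens u (tens v w)).
Proof. 
apply: (bilin_comp2 (tens_bilin _ _) (@lin_id _ _) (tens_linl w)).
Qed.

Lemma tassoc_bilin U V W :
  bilin (fun t (w : W) => tlift (fun (u : U) (v : V) => tens u (tens v w)) t).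
Proof.
split=> [w|t]; first exact/tlift_lin/tassoc_bilin1.
move=> a w w'; move: t; apply: tens_ext.
- exact/tlift_lin/tassoc_bilin1.
- apply: lin_add; last exact/tlift_lin/tassoc_bilin1.
  exact/lin_scale/tlift_lin/tassoc_bilin1.
move=> u v; rewrite !tliftE; try exact: tassoc_bilin1.
by rewrite tens_linr tens_linr.
Qed.

Lemma tassoc_lin U V W : linear (@tassoc U V W).
Proof. exact/tlift_lin/tassoc_bilin. Qed.

Lemma tassocE U V W (u : U) (v : V) (w : W) :
  tassoc (tens (tens u v) w) = tens u (tens v w).
Proof.
by rewrite /tassoc tliftE ?tliftE //; [exact: tassoc_bilin1|exact: tassoc_bilin].
Qed.

End Tensor.

Section GradedTensor.
Variables (k : comPzRingType).
Implicit Types V W : grmod k.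

Definition tpr V W (p : int) : tensor V W -> tensor V W :=
  tlift (fun v w => gsum (fun q v' => tens v' (gpr (p - q) w)) v).

Lemma tpr_bilin V W p :
  bilin (fun (v : V) (w : W) => gsum (fun q v' => tens v' (gpr (p - q) w)) v).
Proof.
split=> [w|v]; first by apply: gsum_lin => q; apply: tens_linl.
apply: lin_bigsum => q _; exact: (lin_comp (tens_linr _) (@gpr_lin _ _ _)).
Qed.

Lemma tpr_lin V W p : linear (@tpr V W p).
Proof. exact/tlift_lin/tpr_bilin. Qed.

Lemma tprE V W p q r (v : V) (w : W) : hom q v -> hom r w ->
  tpr p (tens v w) = if p == q + r then tens v w else 0.
Proof.
move=> hv hw; rewrite /tpr tliftE; last exact: tpr_bilin.
rewrite (gsum_hom _ hv) => [|s]; last exact: tens_linl.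
rewrite (gpr_hom _ hw) subr_eq addrC; case: eqP => // _.
by rewrite (lin0 (tens_linr _)).
Qed.

Lemma tens_hind V W (P : tensor V W -> Prop) :
  P 0 -> (forall u v, P u -> P v -> P (u + v)) -> (forall a u, P u -> P (a *: u)) ->
  (forall p q v w, hom p v -> hom q w -> P (tens v w)) -> forall u, P u.
Proof.
move=> P0 PD PZ Ph; apply: pres_ind => // -[v w]; rewrite -/(tens v w).
move: v; apply: gr_ind => [|u v|p v hv].
- by rewrite (lin0 (tens_linl _)).
- by rewrite (linD (tens_linl _)); apply: PD.
move: w; apply: gr_ind => [|u w|q w hw].
- by rewrite (lin0 (tens_linr _)).
- by rewrite (linD (tens_linr _)); apply: PD.
exact: Ph hv hw.
Qed.

Lemma tens_hext V W (X : lmodType k) (f g : tensor V W -> X) :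
  linear f -> linear g ->
  (forall p q v w, hom p v -> hom q w -> f (tens v w) = g (tens v w)) ->
  forall u, f u = g u.
Proof.
move=> hf hg h; apply: tens_hind => [|u v eu ev|a u eu|//].
- by rewrite (lin0 hf) (lin0 hg).
- by rewrite (linD hf) (linD hg) eu ev.
- by rewrite (linZ hf) (linZ hg) eu.
Qed.

(* finiteness of supports is inherited by linear combinations *)
Lemma fin_ind (V : lmodType k) (pr : int -> V -> V) :
  (forall p, linear (pr p)) ->
  (forall p q v, pr p (pr q v) = if p == q then pr q v else 0) ->
  let F v := exists s : seq int, uniq s && (v == \sum_(p <- s) pr p v) in
  [/\ F 0, forall u v, F u -> F v -> F (u + v) & forall a u, F u -> F (a *: u)].
Proof.
move=> prl prr F; split.
- by exists [::]; rewrite big_nil /=.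
- move=> u v [s /andP[us /eqP eu]] [t /andP[ut /eqP ev]].
  exists (undup (s ++ t)); rewrite undup_uniq /=.
  have sup w r p : w = \sum_(q <- r) pr q w -> p \notin r -> pr p w = 0.
    move=> -> pr_; rewrite (lin_sum (prl p)) big1_seq // => q /andP[_ qr].
    by rewrite prr; case: eqP => // E; rewrite E qr in pr_.
  under eq_bigr do rewrite (linD (prl _)).
  rewrite big_split /=; apply/eqP; congr (_ + _).
    rewrite [LHS]eu; apply: big_uniq_sub; rewrite ?undup_uniq //.
      by move=> p ps; rewrite mem_undup mem_cat ps.
    by move=> p; apply: sup.
  rewrite [LHS]ev; apply: big_uniq_sub; rewrite ?undup_uniq //.
    by move=> p ps; rewrite mem_undup mem_cat ps orbT.
  by move=> p; apply: sup.
move=> a u [s /andP[us /eqP eu]]; exists s; rewrite us /=.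
under eq_bigr do rewrite (linZ (prl _)).
by rewrite -scaler_sumr -eu.
Qed.

Lemma tpr_pr V W p q (u : tensor V W) :
  tpr p (tpr q u) = if p == q then tpr q u else 0.
Proof.
move: u; apply: tens_hext => [||r s v w hv hw].
- by apply: lin_comp; apply: tpr_lin.
- by case: eqP => _; [exact: tpr_lin|exact: lin_cst0].
rewrite (tprE _ hv hw); case: (q =P r + s) => [->|_].
  by rewrite (tprE _ hv hw).
by rewrite (lin0 (@tpr_lin _ _ _)) if_same.
Qed.

Lemma tpr_fin V W (u : tensor V W) :
  exists s : seq int, uniq s && (u == \sum_(p <- s) tpr p u).
Proof.
have [F0 FD FZ] := fin_ind (@tpr_lin V W) (@tpr_pr V W).
move: u; apply: tens_hind => // r s v w hv hw.
by exists [:: r + s]; rewrite /= big_seq1 (tprE _ hv hw) eqxx.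
Qed.

Definition gtensor V W : grmod k :=
  @GrMod k (tensor V W) (@tpr V W) (@tpr_lin V W) (@tpr_pr V W) (@tpr_fin V W).

Lemma hom_tens V W p q (v : V) (w : W) : hom p v -> hom q w ->
  @hom k (gtensor V W) (p + q) (tens v w).
Proof. by move=> hv hw; rewrite /hom /= (tprE _ hv hw) eqxx. Qed.

End GradedTensor.

(* The tensor module T(V), the sum of all the tensor powers of V; a word      *)
(* [:: v1; ...; vn] stands for v1 (x) ... (x) vn.  A family of linear maps    *)
(* f_n from the n-th tensor power of V to W, for all n, is a map f on         *)
(* sequences that is linear in each variable: f_n (v1 (x) ... (x) vn) is      *)
(* f [:: v1; ...; vn].                                                        *)
Section TensorPowers.
Variable k : comPzRingType.
Implicit Types V W : lmodType k.

Definition multilinear V W (f : seq V -> W) : Prop :=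
  forall s t a x y, f (s ++ (a *: x + y) :: t) = a *: f (s ++ x :: t) + f (s ++ y :: t).

Variant multilin_rel V : seq (k * seq V) -> Prop :=
| Multilin s t a x y : multilin_rel
    [:: (a, s ++ x :: t); (1, s ++ y :: t); (-1, s ++ (a *: x + y) :: t)].

Definition tpowers V : lmodType k := presmod (@multilin_rel V).
Definition word V (s : seq V) : tpowers V := pgen (@multilin_rel V) s.
Definition wlift V W (f : seq V -> W) : tpowers V -> W :=
  @plift k _ (@multilin_rel V) W f.

Lemma multilinear_respects V W (f : seq V -> W) :
  multilinear f <-> respects (@multilin_rel V) f.
Proof.
split=> [fm r [s t a x y]|h s t a x y].
  by rewrite /peval !big_cons big_nil /= scale1r scaleN1r addr0 addrA fm subrr.
have := h _ (Multilin s t a x y); rewrite /peval !big_cons big_nil /= scale1r.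
by rewrite scaleN1r addr0 addrA => /eqP; rewrite subr_eq0 => /eqP.
Qed.

Lemma word_multilin V : multilinear (@word V).
Proof. exact/multilinear_respects/pgen_respects. Qed.

Lemma wlift_lin V W (f : seq V -> W) : multilinear f -> linear (wlift f).
Proof. by move=> /multilinear_respects; apply: plift_lin. Qed.

Lemma wliftE V W (f : seq V -> W) s : multilinear f -> wlift f (word s) = f s.
Proof. by move=> /multilinear_respects h; rewrite /wlift plift_gen. Qed.

Lemma word_ext V W (f g : tpowers V -> W) : linear f -> linear g ->
  (forall s, f (word s) = g (word s)) -> forall u, f u = g u.
Proof. exact: pres_ext. Qed.

Lemma multilin_lin V W (f : seq V -> W) s t :
  multilinear f -> linear (fun x => f (s ++ x :: t)).
Proof. by move=> h a x y; apply: h. Qed.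

Lemma multilin_cons V W (f : seq V -> W) t :
  multilinear f -> linear (fun x => f (x :: t)).
Proof. exact: (@multilin_lin _ _ f [::]). Qed.

Lemma multilin_consr V W (f : seq V -> W) x :
  multilinear f -> multilinear (fun t => f (x :: t)).
Proof. by move=> h s t a y z; apply: (h (x :: s)). Qed.

Lemma lin_multilin V W (X : lmodType k) (f : W -> X) (g : seq V -> W) :
  linear f -> multilinear g -> multilinear (fun s => f (g s)).
Proof. by move=> hf hg s t a x y; rewrite hg hf. Qed.

Lemma multilin_rec V W (f : seq V -> W) :
  (forall t, linear (fun x => f (x :: t))) ->
  (forall x, multilinear (fun t => f (x :: t))) -> multilinear f.
Proof. by move=> h1 h2 [|z s] t a x y /=; [apply: h1|apply: h2]. Qed.

Lemma multilin_add V W (f g : seq V -> W) :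
  multilinear f -> multilinear g -> multilinear (fun s => f s + g s).
Proof.
move=> hf hg s t a x y; rewrite hf hg scalerDr !addrA; congr (_ + _).
by rewrite addrAC.
Qed.

(* v (x) - : T(V) -> T(V) *)
Definition wcons V (v : V) : tpowers V -> tpowers V :=
  wlift (fun s => word (v :: s)).

Lemma wcons_multilin V (v : V) : multilinear (fun s => word (v :: s)).
Proof. exact/multilin_consr/word_multilin. Qed.

Lemma wcons_lin V (v : V) : linear (wcons v).
Proof. exact/wlift_lin/wcons_multilin. Qed.

Lemma wconsE V (v : V) s : wcons v (word s) = word (v :: s).
Proof. exact/wliftE/wcons_multilin. Qed.

Lemma wcons_linl V (t : tpowers V) : linear (fun v => wcons v t).
Proof.
move=> a v v'; move: t; apply: word_ext => [||s]; first exact: wcons_lin.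
  by apply: lin_add; [apply: lin_scale|]; apply: wcons_lin.
by rewrite !wconsE (multilin_cons _ (@word_multilin V)).
Qed.

Lemma wcons_bilin V : bilin (@wcons V).
Proof. by split=> [t|v]; [exact: wcons_linl|exact: wcons_lin]. Qed.

End TensorPowers.

Section GradedTensorPowers.
Variable k : comPzRingType.
Implicit Types V W : grmod k.

Fixpoint word_pr V (p : int) (s : seq V) : tpowers V :=
  if s is x :: s' then gsum (fun q y => wcons y (word_pr (p - q) s')) x
  else if p == 0 then word [::] else 0.

Definition wpr V (p : int) : tpowers V -> tpowers V := wlift (@word_pr V p).

(* s is a sequence of homogeneous elements of degrees ps *)
Fixpoint homs V (ps : seq int) (s : seq V) : Prop :=
  match ps, s with
  | [::], [::] => True
  | p :: ps', x :: s' => hom p x /\ homs ps' s'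
  | _, _ => False
  end.

Lemma word_pr_multilin V p : multilinear (@word_pr V p).
Proof.
move=> s; elim: s p => [|z s IH] p t a x y /=.
  by apply: gsum_lin => q; apply: wcons_linl.
rewrite /gsum scaler_sumr -big_split; apply: eq_bigr => q _ /=.
by rewrite IH wcons_lin.
Qed.

Lemma wpr_lin V p : linear (@wpr V p).
Proof. exact/wlift_lin/word_pr_multilin. Qed.

Lemma wprE V p ps (s : seq V) : homs ps s ->
  wpr p (word s) = if p == \sum_(q <- ps) q then word s else 0.
Proof.
rewrite /wpr wliftE; last exact: word_pr_multilin.
elim: s ps p => [|x s IH] [|q ps] p //=; first by rewrite big_nil.
case=> hx hs; rewrite (gsum_hom _ hx) => [|r]; last exact: wcons_linl.
rewrite (IH _ _ hs) big_cons subr_eq addrC; case: eqP => _.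
  by rewrite wconsE.
by rewrite (lin0 (wcons_lin _)).
Qed.

Lemma multilin_hext V (W : lmodType k) (f g : seq V -> W) :
  multilinear f -> multilinear g ->
  (forall ps s, homs ps s -> f s = g s) -> forall s, f s = g s.
Proof.
move=> hf hg h s; elim: s f g hf hg h => [|x s IH] f g hf hg h.
  exact: (h [::]).
move: x; apply: gr_ext => [||p x hx].
- exact: multilin_cons.
- exact: multilin_cons.
apply: (IH (fun s => f (x :: s)) (fun s => g (x :: s))).
- exact: multilin_consr.
- exact: multilin_consr.
by move=> ps t hs; apply: (h (p :: ps)).
Qed.

Lemma word_hind V (P : tpowers V -> Prop) :
  P 0 -> (forall u v, P u -> P v -> P (u + v)) -> (forall a u, P u -> P (a *: u)) ->
  (forall ps s, homs ps s -> P (word s)) -> forall u, P u.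
Proof.
move=> P0 PD PZ Ph; apply: pres_ind => // s; rewrite -/(word s).
suff H (r : seq V) : forall qs, homs qs r -> P (word (r ++ s)) by exact: (H [::] [::]).
elim: s r => [|x s IH] r qs hr; first by rewrite cats0; apply: Ph hr.
move: x; apply: gr_ind => [|u v|p x hx].
- by rewrite (lin0 (multilin_lin _ _ (@word_multilin _ _))).
- by rewrite (linD (multilin_lin _ _ (@word_multilin _ _))); apply: PD.
rewrite -cat_rcons; apply: (IH _ (rcons qs p)).
by elim: r qs hr => [|y r IHr] [|q qs] //= [? ?]; split=> //; apply: IHr.
Qed.

Lemma word_hext V (X : lmodType k) (f g : tpowers V -> X) :
  linear f -> linear g ->
  (forall ps s, homs ps s -> f (word s) = g (word s)) ->
  forall u, f u = g u.
Proof.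
move=> hf hg h; apply: word_hind => [|u v eu ev|a u eu|//].
- by rewrite (lin0 hf) (lin0 hg).
- by rewrite (linD hf) (linD hg) eu ev.
- by rewrite (linZ hf) (linZ hg) eu.
Qed.

Lemma wpr_pr V p q (u : tpowers V) : wpr p (wpr q u) = if p == q then wpr q u else 0.
Proof.
move: u; apply: word_hext => [||ps s hs].
- by apply: lin_comp; apply: wpr_lin.
- by case: eqP => _; [exact: wpr_lin|exact: lin_cst0].
rewrite (wprE _ hs); case: eqP => [->|_].
  by rewrite (wprE _ hs).
by rewrite (lin0 (@wpr_lin _ _)) if_same.
Qed.

Lemma wpr_fin V (u : tpowers V) :
  exists s : seq int, uniq s && (u == \sum_(p <- s) wpr p u).
Proof.
have [F0 FD FZ] := fin_ind (@wpr_lin V) (@wpr_pr V).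
move: u; apply: word_hind => // ps s hs.
by exists [:: \sum_(q <- ps) q]; rewrite /= big_seq1 (wprE _ hs) eqxx.
Qed.

Definition gtpowers V : grmod k :=
  @GrMod k (tpowers V) (@wpr V) (@wpr_lin V) (@wpr_pr V) (@wpr_fin V).

Lemma hom_word V ps (s : seq V) : homs ps s ->
  @hom k (gtpowers V) (\sum_(q <- ps) q) (word s).
Proof. by move=> hs; rewrite /hom /= (wprE _ hs) eqxx. Qed.

End GradedTensorPowers.

Section Operations.
Variable k : comPzRingType.
Implicit Types V W X : grmod k.

(* a family of maps f_n from the n-th tensor power of V to W, of degrees d n *)
Definition deg_multi V W (d : nat -> int) (f : seq V -> W) : Prop :=
  forall ps s, homs ps s -> hom (\sum_(p <- ps) p + d (size s)) (f s).

(* The tensor powers of a map f of degree d:                                  *)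
(* (f (x) f')(x (x) x') = (-1)^(|f'||x|) f x (x) f' x'.                       *)
Fixpoint ptens V W (d : int) (f : V -> W) (s : seq V) : seq W :=
  if s is x :: s' then f (ksgn (d * (size s')%:Z) x) :: ptens d f s' else [::].

(* 1^(x)j (x) m_n (x) 1^(x)l applied to s, where m_n has degree d *)
Definition insert V (d : int) (m : seq V -> V) (j n : nat) (s : seq V) : seq V :=
  [seq ksgn d x | x <- take j s] ++ m (take n (drop j s)) :: drop (j + n) s.

(* sum_(j + n + l = p) (-1)^(jn + l) f_(j+1+l) (1^(x)j (x) m_n (x) 1^(x)l) *)
Definition msum V W (f : seq V -> W) (m : seq V -> V) (s : seq V) : W :=
  \sum_(j < (size s).+1) \sum_(n < (size s - j).+1)
    (-1) ^+ (j * n + (size s - j - n)) *: f (insert (2 - n%:Z) m j n s).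

(* f_(i_1) (x) ... (x) f_(i_r), f_i of degree 1 - i, applied to the blocks bs *)
Fixpoint btens V W (f : seq V -> W) (bs : seq (seq V)) : seq W :=
  if bs is b :: bs' then
    f [seq ksgn (\sum_(c <- bs') (1 - (size c)%:Z)) x | x <- b] :: btens f bs'
  else [::].

(* sum_(2 <= u <= r) (1 - i_u) sum_(1 <= v < u) i_v, indexed from 0 *)
Definition csign (i : seq nat) : int :=
  \sum_(u < size i) (1 - (nth 0 i u)%:Z) * \sum_(v < u) (nth 0 i v)%:Z.

(* sum_(i_1 + ... + i_r = p) (-1)^csign g_r (f_(i_1) (x) ... (x) f_(i_r)),    *)
(* over all r and all i_1, ..., i_r >= 1; for p = 0 only r = 0 contributes.   *)
Definition csum V W (X : grmod k) (g : seq W -> X) (f : seq V -> W) (s : seq V) : X :=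
  \sum_(r < (size s).+1)
    \sum_(i : r.-tuple 'I_(size s).+1
          | all (leq 1) (map val i) && (sumn (map val i) == size s))
      (-1) ^+ `|csign (map val i)|%N *: g (btens f (reshape (map val i) s)).

End Operations.

(* A_[0,oo[-algebras *)
Record ainf (k : comPzRingType) := Ainf {
  acar :> grmod k;
  aop : seq acar -> acar;
  aop_multilin : multilinear aop;
  aop_deg : deg_multi (fun n => 2 - n%:Z) aop;
  aop_rel : forall s, msum aop aop s = 0
}.

Record ainf_hom (k : comPzRingType) (A B : ainf k) := AinfHom {
  afun :> seq A -> B;
  afun_multilin : multilinear afun;
  afun_deg : deg_multi (fun n => 1 - n%:Z) afun;
  afun_nil : afun [::] = 0;  (* no component f_0 *)
  afun_rel : forall s, msum afun (@aop k A) s = csum (@aop k B) afun s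
}.

(* the composition of the category Alg_[0,oo[ *)
Definition acomp (k : comPzRingType) (A B C : ainf k) (g : ainf_hom B C)
  (f : ainf_hom A B) : seq A -> C := csum g f.

(* Alg_[0,2] : curved dg algebras, with their strict morphisms *)
Record cdga (k : comPzRingType) := Cdga {
  cdga_ainf :> ainf k;
  cdgaP : forall s : seq cdga_ainf, (2 < size s)%N -> aop s = 0
}.

Record cdga_hom (k : comPzRingType) (A B : cdga k) := CdgaHom {
  cdga_afun :> ainf_hom A B;
  cdga_afunP : forall s : seq A, (1 < size s)%N -> cdga_afun s = 0
}.

Section Identity.
Variables (k : comPzRingType) (A : cdga k).

Definition idfun_seq (V : lmodType k) (s : seq V) : V := if s is [:: x] then x else 0.

Lemma idfun_seq_size (V : lmodType k) (s : seq V) : size s != 1%N -> idfun_seq s = 0.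
Proof. by case: s => [|x [|y s]]. Qed.

Lemma idfun_seq_multilin (V : lmodType k) : multilinear (@idfun_seq V).
Proof.
move=> s t a x y; case: s => [|z s] /=.
  by case: t => //= *; rewrite scaler0 addr0.
by case: s => [|? ?] /=; rewrite scaler0 addr0.
Qed.

Lemma multilin0 (V W : lmodType k) (f : seq V -> W) s : multilinear f -> 0 \in s -> f s = 0.
Proof.
move=> hf /(nthP 0)[i il i0]; rewrite -(cat_take_drop i s) (drop_nth 0 il) i0.
exact: (lin0 (multilin_lin _ _ hf)).
Qed.

Lemma idfun_seq_deg : deg_multi (fun n => 1 - n%:Z) (@idfun_seq A).
Proof.
move=> ps s hs; case: s hs => [|x [|y s]] /=; [by move=> _; apply: hom0| |by move=> _; apply: hom0].
by case: ps => [|p [|q ps]] //= -[] // hx _; rewrite big_seq1 subrr addr0.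
Qed.

Lemma size_insert (V : grmod k) d (m : seq V -> V) j n s : (j <= size s)%N ->
  size (insert d m j n s) = (j + (size s - (j + n))).+1.
Proof. by move=> h; rewrite size_cat size_map size_takel //= addnS size_drop. Qed.

Lemma msum_idfun s : msum (@idfun_seq A) (@aop k A) s = aop s.
Proof.
rewrite /msum; set p := size s; rewrite big_ord_recl [X in _ + X]big1 ?addr0; last first.
  move=> j _; apply: big1 => n _; rewrite idfun_seq_size ?scaler0 //.
  by rewrite size_insert ?lift0 ?addSn // ltn_ord.
rewrite subn0 big_ord_recr /= big1 ?add0r; last first.
  move=> n _; rewrite idfun_seq_size ?scaler0 //.
  rewrite /insert take0 /= size_drop add0n eqSS subn_eq0 -ltnNge.
  exact: ltn_ord.
by rewrite /insert take0 /= drop0 add0n take_size drop_size subnn expr0 scale1r.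
Qed.

Lemma btens_id0 (bs : seq (seq A)) :
  has (fun b => size b != 1%N) bs -> 0 \in btens (@idfun_seq A) bs.
Proof.
elim: bs => //= b bs IH /orP[nb|/IH h]; rewrite inE ?h ?orbT //.
by rewrite idfun_seq_size ?eqxx // size_map.
Qed.

Lemma btens_id1 (s : seq A) :
  btens (@idfun_seq A) (reshape (nseq (size s) 1%N) s) = s.
Proof.
elim: s => //= x s IH; rewrite take0 drop0 IH; congr (_ :: _).
rewrite (_ : \sum_(c <- _) _ = 0) ?ksgn0 //.
elim: s {IH} => [|y s IH] /=; first by rewrite big_nil.
by rewrite big_cons /= take0 drop0 IH.
Qed.

Lemma csign_nseq1 n : csign (nseq n 1%N) = 0.
Proof.
rewrite /csign big1 // => u _; rewrite nth_nseq.
by case: u => u /=; rewrite size_nseq => ->; rewrite subrr mul0r.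
Qed.

Lemma sumn_ge (l : seq nat) : all (leq 1) l -> (size l <= sumn l)%N.
Proof. by elim: l => //= a l IH /andP[a1 /IH]; rewrite -add1n; apply: leq_add. Qed.

Lemma parts_ones (l : seq nat) :
  all (leq 1) l -> sumn l = size l -> l = nseq (size l) 1%N.
Proof.
elim: l => //= a l IH /andP[a1 al] e.
have := sumn_ge al => h.
have a1' : a = 1%N.
  apply/eqP; rewrite eqn_leq a1 andbT -(leq_add2r (sumn l)) e add1n ltnS.
  exact: h.
by rewrite a1'; congr (_ :: _); apply: IH => //; move: e; rewrite a1' add1n => -[].
Qed.

Lemma csum_idfun s : csum (@aop k A) (@idfun_seq A) s = aop s.
Proof.
rewrite /csum; set p := size s.
have sm := @aop_multilin k A.
rewrite big_ord_recr /= big1 ?add0r; last first.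
  move=> r _; apply: big1 => i /andP[i1 /eqP ip].
  rewrite (multilin0 sm) ?scaler0 //; apply: btens_id0.
  have sz : shape (reshape (map val i) s) = map val i by apply: reshapeKl; rewrite ip.
  rewrite -[has _ _](has_map size (fun m => m != 1%N)) -/(shape _) sz.
  apply/negPn/negP; rewrite -all_predC => /allP h.
  have e : map val i = nseq r 1%N.
    rewrite -[in RHS](size_tuple i) -(size_map val i); apply/all_pred1P/allP => m /h /=.
    by rewrite negbK.
  by move: ip; rewrite e sumn_nseq mul1n => E; have := ltn_ord r; rewrite E ltnn.
have pp : (p >= 0)%N by [].
pose one : 'I_p.+1 := inord 1.
pose i0 : p.-tuple 'I_p.+1 := nseq_tuple p one.
have e0 : map val i0 = nseq p 1%N.
  have nseq0 a b : p = 0%N -> nseq p a = nseq p b :> seq nat by move=> ->.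
  rewrite /i0 /= map_nseq; case: (posnP p) => [/nseq0|p0]; first exact.
  by rewrite /one inordK.
rewrite (bigD1 i0) /=; last first.
  rewrite -/(map _ i0) e0 sumn_nseq mul1n eqxx andbT.
  by apply/allP => m /nseqP[->].
rewrite big1 ?addr0 => [|i /andP[/andP[i1 /eqP ip] ne]]; last first.
  case/negP: ne; apply/eqP/val_inj/(inj_map val_inj).
  rewrite -[RHS]/(map val i0) e0 -[X in nseq X](size_tuple i) -(size_map val i).
  by apply: parts_ones => //; rewrite ip size_map size_tuple.
by rewrite -/(map val i0) e0 csign_nseq1 expr0 scale1r btens_id1.
Qed.

Definition ainf_id : ainf_hom A A :=
  @AinfHom k A A (@idfun_seq A) (@idfun_seq_multilin A) idfun_seq_deg erefl
    (fun s => etrans (msum_idfun s) (esym (csum_idfun s))).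

Definition cdga_id : cdga_hom A A :=
  @CdgaHom k A A ainf_id (fun s hs => @idfun_seq_size A s ltac:(by case: s hs => [|? []])).

End Identity.

Section Cokernel.
Variables (k : comPzRingType) (U V : lmodType k) (f : U -> V).

Variant cok_rel : seq (k * V) -> Prop :=
| CokLin a x y : cok_rel [:: (a, x); (1, y); (-1, a *: x + y)]
| CokIm u : cok_rel [:: (1, f u)].

Definition cok : lmodType k := presmod cok_rel.
Definition cokpr (v : V) : cok := pgen cok_rel v.
Definition coklift (W : lmodType k) (g : V -> W) : cok -> W :=
  @plift k V cok_rel W g.

Lemma cok_respects (W : lmodType k) (g : V -> W) :
  (linear g /\ forall u, g (f u) = 0) <-> respects cok_rel g.
Proof.
split=> [[gl g0] r|h].
  case=> [a x y|u]; rewrite /peval !big_cons big_nil /= scale1r addr0 ?g0 //.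
  by rewrite scaleN1r addrA gl subrr.
split=> [a x y|u].
  have := h _ (CokLin a x y); rewrite /peval !big_cons big_nil /= scale1r.
  by rewrite scaleN1r addr0 addrA => /eqP; rewrite subr_eq0 => /eqP.
by have := h _ (CokIm u); rewrite /peval !big_cons big_nil /= scale1r addr0.
Qed.

Lemma cokpr_lin : linear cokpr.
Proof. by have [] := (cok_respects cokpr).2 (@pgen_respects _ _ cok_rel). Qed.

Lemma cokpr0 u : cokpr (f u) = 0.
Proof. by have [_] := (cok_respects cokpr).2 (@pgen_respects _ _ cok_rel); apply. Qed.

Lemma coklift_lin (W : lmodType k) (g : V -> W) :
  linear g -> (forall u, g (f u) = 0) -> linear (coklift g).
Proof. by move=> gl g0; apply/plift_lin/cok_respects. Qed.

Lemma cokliftE (W : lmodType k) (g : V -> W) v :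
  linear g -> (forall u, g (f u) = 0) -> coklift g (cokpr v) = g v.
Proof. by move=> gl g0; rewrite /coklift plift_gen //; apply/cok_respects. Qed.

Lemma cok_surj (u : cok) : exists v, u = cokpr v.
Proof.
move: u; apply: pres_ind => [|_ _ [v ->] [w ->]|a _ [v ->]|v].
- by exists 0; rewrite (lin0 cokpr_lin).
- by exists (v + w); rewrite (linD cokpr_lin).
- by exists (a *: v); rewrite (linZ cokpr_lin).
by exists v.
Qed.

End Cokernel.

(* The iterated comultiplication C -> C^(x)(n+1) of D : C -> C (x) C.         *)
Fixpoint itcomul (k : comPzRingType) (C : lmodType k) (D : C -> tensor C C)
    (n : nat) : C -> tpowers C :=
  if n is n'.+1
  then fun c => tlift (fun x y => wcons x (itcomul D n' y)) (D c)
  else fun c => word [:: c].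

(* the comultiplication induced by D on the cokernel of e *)
Definition redcomul (k : comPzRingType) (U C : lmodType k) (e : U -> C)
  (D : C -> tensor C C) : cok e -> tensor (cok e) (cok e) :=
  coklift (fun c => tmap (cokpr e) (cokpr e) (D c)).
Arguments redcomul {k U C} e D _.

(* The category CgaCdg.  The unit ceps : k -> C need not commute with cd.     *)
Record cgacdg (k : comPzRingType) := Cgacdg {
  ccar :> grmod k;
  cd : ccar -> ccar;
  cdelta : ccar -> gtensor ccar ccar;
  ceta : ccar -> gunit k;
  ceps : gunit k -> ccar;
  cd_lin : linear cd;
  cdelta_lin : linear cdelta;
  ceta_lin : linear ceta;
  ceps_lin : linear ceps;
  cd_deg : deg_map 1 cd;
  cdelta_deg : deg_map 0 cdelta;
  ceta_deg : deg_map 0 ceta;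
  ceps_deg : deg_map 0 ceps;
  cdelta_assoc : forall c,
    tassoc (tmap cdelta idfun (cdelta c)) = tmap idfun cdelta (cdelta c);
  ceta_l : forall c, tlift (fun x y => ceta x *: y) (cdelta c) = c;
  ceta_r : forall c, tlift (fun x y => ceta y *: x) (cdelta c) = c;
  cd_sq : forall c, cd (cd c) = 0;
  (* ksgn 1 is the Koszul sign of 1 (x) d *)
  cd_coder : forall c,
    cdelta (cd c) = tmap cd idfun (cdelta c) + tmap (ksgn 1) cd (cdelta c);
  ceta_d : forall c, ceta (cd c) = 0;
  ceta_eps : forall a, ceta (ceps a) = a;
  cdelta_eps : forall a : k, cdelta (ceps a) = a *: tens (ceps 1) (ceps 1);
  (* every element of the reduced coalgebra is in the kernel of an iterated   *)
  (* reduced comultiplication                                                 *)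
  ccocomplete : forall c : cok ceps, exists n, itcomul (redcomul ceps cdelta) n c = 0
}.

Record cgacdg_hom (k : comPzRingType) (C D : cgacdg k) := CgacdgHom {
  cfun :> C -> D;
  cfun_lin : linear cfun;
  cfun_deg : deg_map 0 cfun;
  cfun_d : forall c, cfun (cd c) = cd (cfun c);
  cfun_delta : forall c, cdelta (cfun c) = tmap cfun cfun (cdelta c);
  cfun_eta : forall c, ceta (cfun c) = ceta c;
  cfun_eps : forall a : k, cfun (ceps C a) = ceps D a
}.

(* Tw(C, A).  By cocompleteness only finitely many terms of the sum over n    *)
(* are nonzero on a given c: its partial sums are eventually constant.        *)
Record is_tw (k : comPzRingType) (C : cgacdg k) (A : ainf k) (tau : C -> A) : Prop :=
  IsTw {
  tw_lin : linear tau;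
  tw_deg : deg_map 1 tau;
  tw_eps : forall a : k, tau (ceps C a) = 0;
  tw_eq : forall c, exists N, forall M, (N <= M)%N ->
    (ceta c : k) *: aop ([::] : seq A) + (aop [:: tau c] + tau (cd c))
    + \sum_(2 <= n < M)
        wlift (fun s => aop (ptens 1 tau s)) (itcomul (@cdelta k C) n.-1 c) = 0
}.

(* Sums over the ways of cutting a sequence in two. *)
Section SplitSum.
Variable k : comPzRingType.
Implicit Types V W X : lmodType k.

Definition splitsum (T : Type) W (G : seq T -> seq T -> W) (s : seq T) : W :=
  \sum_(n < (size s).+1) G (take n s) (drop n s).

Lemma splitsum_nil T W (G : seq T -> seq T -> W) : splitsum G [::] = G [::] [::].
Proof. by rewrite /splitsum big_ord_recl big_ord0 addr0. Qed.

Lemma splitsum_cons T W (G : seq T -> seq T -> W) x s :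
  splitsum G (x :: s) = G [::] (x :: s) + splitsum (fun u v => G (x :: u) v) s.
Proof. by rewrite /splitsum big_ord_recl take0 drop0. Qed.

Lemma eq_splitsum T W (G H : seq T -> seq T -> W) s :
  (forall u v, G u v = H u v) -> splitsum G s = splitsum H s.
Proof. by move=> E; apply: eq_bigr => n _. Qed.

Lemma splitsumD T W (G H : seq T -> seq T -> W) s :
  splitsum (fun u v => G u v + H u v) s = splitsum G s + splitsum H s.
Proof. exact: big_split. Qed.

Lemma splitsumN T W (G : seq T -> seq T -> W) s :
  splitsum (fun u v => - G u v) s = - splitsum G s.
Proof. by rewrite /splitsum sumrN. Qed.

Lemma lin_splitsum T W X (f : W -> X) (G : seq T -> seq T -> W) s : linear f ->
  f (splitsum G s) = splitsum (fun u v => f (G u v)) s.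
Proof. by move=> hf; rewrite /splitsum (lin_sum hf). Qed.

Lemma splitsum_map T T' W (h : T' -> T) (G : seq T -> seq T -> W) s :
  splitsum G (map h s) = splitsum (fun u v => G (map h u) (map h v)) s.
Proof.
by rewrite /splitsum size_map; apply: eq_bigr => n _; rewrite map_take map_drop.
Qed.

Lemma splitsumA T W (G : seq T -> seq T -> seq T -> W) s :
  splitsum (fun u w => splitsum (fun u1 u2 => G u1 u2 w) u) s
  = splitsum (fun u v => splitsum (fun v1 v2 => G u v1 v2) v) s.
Proof.
elim: s G => [|x s IH] G; first by rewrite !splitsum_nil.
rewrite !splitsum_cons splitsum_nil -addrA; congr (_ + _).
rewrite -IH -splitsumD; apply: eq_splitsum => u w.
by rewrite splitsum_cons.
Qed.

Lemma splitsum_cat T W (G : seq T -> seq T -> W) s y t :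
  splitsum G (s ++ y :: t) =
  splitsum (fun a a' => G a (a' ++ y :: t)) s
  + splitsum (fun c c' => G (s ++ y :: c) c') t.
Proof.
elim: s G => [|x s IH] G; first by rewrite /= splitsum_cons splitsum_nil.
by rewrite /= !splitsum_cons IH addrA.
Qed.

Lemma splitsum_exchange T T' W (G : seq T -> seq T -> seq T' -> seq T' -> W) s t :
  splitsum (fun a b => splitsum (fun c d => G a b c d) t) s
  = splitsum (fun c d => splitsum (fun a b => G a b c d) s) t.
Proof. exact: exchange_big. Qed.

Lemma splitsum_multilin V W (G : seq V -> seq V -> W) :
  (forall v, multilinear (G^~ v)) -> (forall u, multilinear (G u)) ->
  multilinear (splitsum G).
Proof.
move=> hl hr s; elim: s G hl hr => [|z s IH] G hl hr t a x y.
  rewrite /= !splitsum_cons scalerDr [RHS]addrACA.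
  congr (_ + _); first exact: (hr [::] [::]).
  rewrite /splitsum scaler_sumr -big_split; apply: eq_bigr => n _ /=.
  exact: (hl _ [::]).
rewrite /= !splitsum_cons scalerDr [RHS]addrACA.
congr (_ + _); first exact: (hr [::] (z :: s)).
by apply: IH => [v|u]; [exact: (multilin_consr z (hl v))|exact: hr].
Qed.

End SplitSum.

(* Deconcatenation on T(V), its counit, its augmentation. *)
Section Deconcatenation.
Variables (k : comPzRingType) (V : grmod k).

Definition decat_word (s : seq V) : gtensor (gtpowers V) (gtpowers V) :=
  \sum_(n < (size s).+1) tens (word (take n s)) (word (drop n s)).
Definition decat : gtpowers V -> gtensor (gtpowers V) (gtpowers V) :=
  wlift decat_word.

Definition tcounit_word (s : seq V) : gunit k := (nilp s)%:R.
Definition tcounit : gtpowers V -> gunit k := wlift tcounit_word.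

Definition taug (a : gunit k) : gtpowers V := (a : k) *: word [::].

(* the projection T(V) -> V *)
Definition tproj : gtpowers V -> V := wlift (@idfun_seq k V).

Lemma decat_word_multilin : multilinear decat_word.
Proof.
apply: (@splitsum_multilin k V (tensor (tpowers V) (tpowers V))
  (fun u v => tens (word u) (word v))) => [v|u].
  exact: (lin_multilin (tens_linl _) (@word_multilin _ _)).
exact: (lin_multilin (tens_linr _) (@word_multilin _ _)).
Qed.

Lemma decatE s : decat (word s) =
  @splitsum k V (tensor (tpowers V) (tpowers V)) (fun u v => tens (word u) (word v)) s.
Proof. by rewrite /decat wliftE //; apply: decat_word_multilin. Qed.

Lemma decat_lin : linear decat.
Proof. exact/wlift_lin/decat_word_multilin. Qed.

Lemma tcounit_multilin : multilinear tcounit_word.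
Proof.
by move=> [|? ?] t a x y; rewrite /tcounit_word /nilp /= scaler0 addr0.
Qed.

Lemma tcounit_lin : linear tcounit.
Proof. exact/wlift_lin/tcounit_multilin. Qed.

Lemma tcounitE s : tcounit (word s) = (nilp s)%:R.
Proof. by rewrite /tcounit wliftE //; apply: tcounit_multilin. Qed.

Lemma taug_lin : linear taug.
Proof. by move=> a x y; rewrite /taug scalerDl scalerA. Qed.

Lemma tproj_lin : linear tproj.
Proof. exact/wlift_lin/idfun_seq_multilin. Qed.

Lemma deg_map_words (W : grmod k) d (f : gtpowers V -> W) : linear f ->
  (forall ps (s : seq V), homs ps s -> hom (\sum_(p <- ps) p + d) (f (word s))) ->
  deg_map d f.
Proof.
move=> hf h p v hv; rewrite /hom -{}hv; move: v.
apply: (@word_hext k V W (fun v : gtpowers V => gpr (p + d) (f (gpr p v)))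
  (fun v : gtpowers V => f (gpr p v))).
- by move=> a x y; rewrite (@gpr_lin k (gtpowers V)) hf gpr_lin.
- by move=> a x y; rewrite (@gpr_lin k (gtpowers V)) hf.
move=> ps s hs; rewrite /= (wprE _ hs); case: eqP => [->|_]; first exact: h.
by rewrite (lin0 hf) (lin0 (@gpr_lin _ _ _)).
Qed.

Lemma homs_take n ps (s : seq V) : homs ps s -> homs (take n ps) (take n s).
Proof.
elim: s ps n => [|x s IH] [|p ps] [|n] //= [hx hs]; split=> //; exact: IH.
Qed.
Lemma homs_drop n ps (s : seq V) : homs ps s -> homs (drop n ps) (drop n s).
Proof. by elim: s ps n => [|x s IH] [|p ps] [|n] //= [hx hs]; apply: IH. Qed.
Lemma homs_cat ps qs (s t : seq V) : homs ps s -> homs qs t -> homs (ps ++ qs) (s ++ t).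
Proof. by elim: s ps => [|x s IH] [|p ps] //= [hx hs] ht; split=> //; apply: IH. Qed.
Lemma homs_ksgn d ps (s : seq V) : homs ps s -> homs ps (map (ksgn d) s).
Proof.
by elim: s ps => [|x s IH] [|p ps] //= [hx hs]; split; [exact: hom_ksgn|exact: IH].
Qed.
Lemma size_homs ps (s : seq V) : homs ps s -> size ps = size s.
Proof. by elim: s ps => [|x s IH] [|p ps] //= [hx /IH ->]. Qed.

Lemma decat_deg : deg_map 0 decat.
Proof.
apply: deg_map_words; first exact: decat_lin.
move=> ps s hs; rewrite addr0 decatE; apply: hom_sum => n _.
rewrite -[ps](cat_take_drop n) big_cat /=.
by apply: hom_tens; apply: hom_word; [exact: homs_take|exact: homs_drop].
Qed.

Lemma tcounit_deg : deg_map 0 tcounit.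
Proof.
apply: deg_map_words; first exact: tcounit_lin.
move=> [|p ps] [|x s] // hs; rewrite addr0 tcounitE; last exact: hom0.
by rewrite big_nil.
Qed.

Lemma taug_deg : deg_map 0 taug.
Proof.
move=> p a; rewrite /hom /= addr0; case: (p =P 0) => [->|/eqP p0] ha.
  rewrite /taug (linZ (@wpr_lin _ _ _)) (@wprE k V 0 [::] [::]) //.
  by rewrite big_nil eqxx.
by rewrite -ha /taug scale0r (lin0 (@wpr_lin _ _ _)).
Qed.

Lemma lin_ididfun (W : lmodType k) : linear (@idfun W). Proof. by []. Qed.

Lemma decat_assoc c :
  tassoc (tmap decat idfun (decat c)) = tmap idfun decat (decat c).
Proof.
move: c; apply: word_ext => [||s].
- apply: (lin_comp (@tassoc_lin _ _ _ _)); apply: lin_comp; last exact: decat_lin.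
  exact: tmap_lin decat_lin _.
- apply: lin_comp; last exact: decat_lin.
  by apply: tmap_lin => //; exact: decat_lin.
rewrite decatE (lin_splitsum _ _ (tmap_lin decat_lin (@lin_ididfun _))).
rewrite (lin_splitsum _ _ (@tassoc_lin _ _ _ _)).
rewrite (lin_splitsum _ _ (tmap_lin (@lin_ididfun _) decat_lin)).
transitivity (splitsum (fun u v => splitsum (fun v1 v2 =>
    tens (word u) (tens (word v1) (word v2))) v) s); last first.
  apply: eq_splitsum => u v; rewrite tmapE //; last exact: decat_lin.
  by rewrite decatE (lin_splitsum _ _ (tens_linr _)).
rewrite -splitsumA; apply: eq_splitsum => u v.
rewrite tmapE //; last exact: decat_lin.
rewrite decatE (lin_splitsum _ _ (tens_linl _)) (lin_splitsum _ _ (@tassoc_lin _ _ _ _)).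
by apply: eq_splitsum => u1 u2; rewrite tassocE.
Qed.

Lemma tcounit_bilinl : bilin (fun x y : gtpowers V => (tcounit x : k) *: y).
Proof.
split=> [w a x y|v a x y].
  by rewrite (tcounit_lin a) scalerDl scalerA.
by rewrite scalerDr !scalerA mulrC.
Qed.

Lemma tcounit_bilinr : bilin (fun x y : gtpowers V => (tcounit y : k) *: x).
Proof. by have [h1 h2] := tcounit_bilinl; split=> ?; [apply: h2|apply: h1]. Qed.

Lemma tcounit_l c : tlift (fun x y => (tcounit x : k) *: y) (decat c) = c.
Proof.
move: c; apply: word_ext => [||s]; last 1 first.
- rewrite decatE (lin_splitsum _ _ (tlift_lin tcounit_bilinl)).
  rewrite /splitsum big_ord_recl big1 => [|n _].
    by rewrite (tliftE _ _ tcounit_bilinl) take0 drop0 tcounitE scale1r addr0.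
  rewrite (tliftE _ _ tcounit_bilinl) tcounitE.
  by case: s n => [[]//|x s n] /=; rewrite scale0r.
- by apply: (lin_comp (tlift_lin tcounit_bilinl)); exact: decat_lin.
exact: lin_id.
Qed.

Lemma tcounit_r c : tlift (fun x y => (tcounit y : k) *: x) (decat c) = c.
Proof.
move: c; apply: word_ext => [||s]; last 1 first.
- rewrite decatE (lin_splitsum _ _ (tlift_lin tcounit_bilinr)).
  rewrite /splitsum big_ord_recr big1 => [|n _].
    by rewrite /= (tliftE _ _ tcounit_bilinr) take_size drop_size tcounitE scale1r add0r.
  rewrite (tliftE _ _ tcounit_bilinr) tcounitE.
  by case: n => n /= hn; rewrite /nilp size_drop subn_eq0 leqNgt hn scale0r.
- by apply: (lin_comp (tlift_lin tcounit_bilinr)); exact: decat_lin.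
exact: lin_id.
Qed.

Lemma tcounit_aug a : tcounit (taug a) = a.
Proof. by rewrite /taug (linZ tcounit_lin) tcounitE /GRing.scale /= mulr1. Qed.

Lemma decat_aug (a : k) : decat (taug a) = a *: tens (taug (1 : k)) (taug (1 : k)).
Proof. by rewrite /taug scale1r (linZ decat_lin) decatE splitsum_nil. Qed.

Lemma redcomulE c : redcomul taug decat (cokpr taug c) =
  tmap (cokpr taug) (cokpr taug) (decat c).
Proof.
have cl := @cokpr_lin k _ _ taug.
rewrite /redcomul cokliftE //.
  by apply: lin_comp; [exact: tmap_lin|exact: decat_lin].
move=> a; rewrite decat_aug (linZ (tmap_lin cl cl)) tmapE //.
by rewrite cokpr0 (lin0 (tens_linl _)) scaler0.
Qed.

Lemma itcomul_word n (s : seq V) : (size s <= n)%N ->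
  itcomul (redcomul taug decat) n (cokpr taug (word s)) = 0.
Proof.
have c0 : cokpr taug (word [::]) = 0 by rewrite -[word _]scale1r -/(taug (1 : k)) cokpr0.
have cl := @cokpr_lin k _ _ taug.
have itl m : linear (itcomul (redcomul taug decat) m).
  elim: m => [|m IH] /=; first exact/multilin_cons/word_multilin.
  have b : bilin (fun x y => wcons x (itcomul (redcomul taug decat) m y)).
    by apply: (bilin_comp2 (wcons_bilin _) (@lin_id _ _) IH).
  apply: (lin_comp (tlift_lin b)).
  move=> a x y; have [x' ->] := cok_surj x; have [y' ->] := cok_surj y.
  by rewrite -cl !redcomulE decat_lin (tmap_lin cl cl).
elim: n s => [|n IH] s.
  rewrite leqn0 size_eq0 => /eqP -> /=; rewrite c0.
  exact: (lin0 (itl 0%N)).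
move=> sn /=; rewrite redcomulE decatE.
have b : bilin (fun x y => wcons x (itcomul (redcomul taug decat) n y)).
  by apply: (bilin_comp2 (wcons_bilin _) (@lin_id _ _) (itl n)).
rewrite (lin_splitsum _ _ (tmap_lin cl cl)) (lin_splitsum _ _ (tlift_lin b)).
rewrite /splitsum big1 // => -[[|m] /= _] _.
  by rewrite tmapE // tliftE // take0 c0 (lin0 (wcons_linl _)).
rewrite tmapE // tliftE // IH ?(lin0 (wcons_lin _)) //.
by rewrite size_drop leq_subLR (leq_trans sn) // addSn ltnS leq_addl.
Qed.

Lemma decat_cocomplete (c : cok taug) :
  exists n, itcomul (redcomul taug decat) n c = 0.
Proof.
have cl := @cokpr_lin k _ _ taug.
have itl m : linear (itcomul (redcomul taug decat) m).
  elim: m => [|m IH] /=; first exact/multilin_cons/word_multilin.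
  have b : bilin (fun x y => wcons x (itcomul (redcomul taug decat) m y)).
    by apply: (bilin_comp2 (wcons_bilin _) (@lin_id _ _) IH).
  apply: (lin_comp (tlift_lin b)).
  move=> a x y; have [x' ->] := cok_surj x; have [y' ->] := cok_surj y.
  by rewrite -cl !redcomulE decat_lin (tmap_lin cl cl).
have [v ->] := cok_surj c.
suff [n h] : exists n, forall m, (n <= m)%N ->
    itcomul (redcomul taug decat) m (cokpr taug v) = 0 by exists n; apply: h.
move: v; apply: pres_ind => [|u v [n hn] [m hm]|a u [n hn]|s].
- by exists 0%N => m _; rewrite (lin0 cl) (lin0 (itl m)).
- exists (maxn n m) => p; rewrite geq_max => /andP[np mp].
  by rewrite (linD cl) (linD (itl p)) hn ?hm ?addr0.
- by exists n => m nm; rewrite (linZ cl) (linZ (itl m)) hn ?scaler0.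
by exists (size s) => m sm; apply: itcomul_word.
Qed.

End Deconcatenation.

Section SignLemmas.
Variable k : comPzRingType.
Implicit Types V W : grmod k.

Lemma multilin_map V (W : lmodType k) (U : lmodType k) (h : U -> V) (f : seq V -> W) :
  linear h -> multilinear f -> multilinear (fun s => f (map h s)).
Proof. by move=> hh hf s t a x y; rewrite !map_cat /= hh hf. Qed.

Lemma multilin_ksgn V (W : lmodType k) d (f : seq V -> W) :
  multilinear f -> multilinear (fun s => f (map (ksgn d) s)).
Proof. by apply: multilin_map; exact: ksgn_lin. Qed.

Lemma multilin_map_hom V (W : lmodType k) d (f : seq V -> W) ps s :
  multilinear f -> homs ps s ->
  f (map (ksgn d) s) = (-1) ^+ `|(d * \sum_(p <- ps) p)%R|%N *: f s.
Proof.
elim: s f ps => [|x s IH] f [|p ps] //= hf; first by rewrite big_nil mulr0 expr0 scale1r.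
case=> hx hs; rewrite big_cons mulrDr sgnD -scalerA.
rewrite (IH (fun s => f (ksgn d x :: s)) ps) //; last exact: (multilin_consr (ksgn d x) hf).
by rewrite (ksgn_hom _ hx) (linZ (multilin_cons _ hf)) !scalerA mulrC.
Qed.

Lemma ksgn_word V d (s : seq V) :
  @ksgn k (gtpowers V) d (word s) = word (map (ksgn d) s).
Proof.
move: s; apply: multilin_hext => [||ps s hs].
- by move=> u t a x y; rewrite word_multilin (@ksgn_lin k (gtpowers V)).
- exact/multilin_ksgn/word_multilin.
rewrite (multilin_map_hom _ (@word_multilin _ _) hs).
exact: (ksgn_hom d (hom_word hs)).
Qed.

Lemma ksgn_multi V W (d : nat -> int) e (f : seq V -> W) s :
  multilinear f -> deg_multi d f ->
  ksgn e (f s) = (-1) ^+ `|(e * d (size s))%R|%N *: f (map (ksgn e) s).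
Proof.
move=> hf df; move: s.
suff H n s : size s = n ->
  ksgn e (f s) = (-1) ^+ `|(e * d n)%R|%N *: f (map (ksgn e) s).
  by move=> s; apply: H.
pose g s := if size s == n then f s else 0.
have hg : multilinear g.
  move=> u t a x y; rewrite /g !size_cat /=; case: eqP => _; first exact: hf.
  by rewrite scaler0 addr0.
suff H : forall s, ksgn e (g s) = (-1) ^+ `|(e * d n)%R|%N *: g (map (ksgn e) s).
  by move=> sn; move: (H s); rewrite /g size_map sn eqxx.
apply: multilin_hext => [||ps t ht].
- by apply: lin_multilin => //; exact: ksgn_lin.
- move=> u t a x y; rewrite (multilin_ksgn e hg) scalerDr !scalerA.
  by rewrite mulrC.
rewrite (multilin_map_hom _ hg ht) /g; case: eqP => [tn|_]; last first.
  by rewrite !scaler0 (lin0 (@ksgn_lin _ _ _)).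
by rewrite (ksgn_hom _ (df _ _ ht)) tn scalerA mulrDr sgnD mulrC.
Qed.

Lemma multilin_scale_map (V W : lmodType k) (f : seq V -> W) (a : k) s t :
  multilinear f -> f (map (fun x => a *: x) s ++ t) = a ^+ size s *: f (s ++ t).
Proof.
elim: s f => [|x s IH] f hf /=; first by rewrite expr0 scale1r.
rewrite (linZ (multilin_cons _ hf)) (IH (fun u => f (x :: u))); last exact: (multilin_consr x hf).
by rewrite scalerA exprS.
Qed.

Lemma hom_wcons V p q (x : V) (t : gtpowers V) : hom p x -> hom q t ->
  @hom k (gtpowers V) (p + q) (wcons x t).
Proof.
move=> hx; have dm : @deg_map k (gtpowers V) (gtpowers V) p (wcons x).
  apply: deg_map_words; first exact: wcons_lin.
  move=> ps s hs; rewrite wconsE addrC.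
  have := @hom_word k V (p :: ps) (x :: s); rewrite big_cons; apply.
  by split.
by move=> ht; rewrite addrC; apply: dm.
Qed.

End SignLemmas.

(* The coderivation of T(V), with projection b to V. *)
Section Coderivation.
Variables (k : comPzRingType) (V : grmod k) (b : seq V -> V).
Hypotheses (b_multilin : multilinear b) (b_deg : deg_multi (fun _ => 1) b).

Definition coder_word (s : seq V) : gtpowers V :=
  \sum_(j < (size s).+1) \sum_(n < (size s - j).+1) word (insert 1 b j n s).
Definition coder : gtpowers V -> gtpowers V := wlift coder_word.

Local Notation TV := (tpowers V).
Local Notation sg := (map (@ksgn k V 1)).

Lemma coder_wordE s : coder_word s =
  @splitsum k V TV (fun u z =>
    @splitsum k V TV (fun v w => word (sg u ++ b v :: w)) z) s.
Proof.
apply: eq_bigr => j _; rewrite /splitsum size_drop; apply: eq_bigr => n _.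
by rewrite /insert drop_drop addnC.
Qed.

Lemma coder_word_multilin : multilinear coder_word.
Proof.
move=> s t a x y; rewrite !coder_wordE; move: s t a x y.
apply: splitsum_multilin => [z|u].
  apply: (@multilin_ksgn k V TV 1 (fun u => splitsum (fun v w => word (u ++ b v :: w)) z)).
  move=> s t a x y; rewrite /splitsum scaler_sumr -big_split; apply: eq_bigr => n _.
  by rewrite -!catA /= word_multilin.
apply: splitsum_multilin => [w|v].
  by move=> s t a x y; rewrite b_multilin word_multilin.
move=> s t a x y; have := @word_multilin k V (sg u ++ b v :: s) t a x y.
by rewrite -!catA.
Qed.

Lemma coder_lin : linear coder.
Proof. exact/wlift_lin/coder_word_multilin. Qed.

Lemma coderE s : coder (word s) =
  @splitsum k V TV (fun u z =>
    @splitsum k V TV (fun v w => word (sg u ++ b v :: w)) z) s.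
Proof. by rewrite /coder wliftE ?coder_wordE //; apply: coder_word_multilin. Qed.

Lemma coder_deg : deg_map 1 coder.
Proof.
apply: deg_map_words; first exact: coder_lin.
move=> ps s hs; rewrite coderE.
apply: hom_sum => j _; apply: hom_sum => n _.
rewrite -[ps](cat_take_drop j) big_cat /= -[drop j ps](cat_take_drop n) big_cat /=.
have h1 := homs_take j hs; have h2 := homs_take n (homs_drop j hs).
have h3 := homs_drop n (homs_drop j hs).
have := @hom_word k V (take j ps ++ (\sum_(p <- take n (drop j ps)) p + 1) :: drop n (drop j ps))
  (sg (take j s) ++ b (take n (drop j s)) :: drop n (drop j s)).
rewrite big_cat big_cons /= -!addrA [1 + _]addrC; apply.
by apply: homs_cat; [exact: homs_ksgn|split=> //; exact: (b_deg h2)].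
Qed.

Lemma tcounit_coder c : tcounit (coder c) = 0.
Proof.
move: c; apply: word_ext => [||s].
- by apply: lin_comp; [exact: tcounit_lin|exact: coder_lin].
- exact: lin_cst0.
rewrite coderE (lin_splitsum _ _ (@tcounit_lin _ _)).
rewrite /splitsum big1 // => j _; rewrite (lin_sum (@tcounit_lin _ _)) big1 // => n _.
by rewrite tcounitE; case: (map _ _).
Qed.

Lemma decat_coder c :
  decat (coder c) = tmap coder idfun (decat c) + tmap (ksgn 1) coder (decat c).
Proof.
have il : linear (@idfun TV) by [].
have sl : linear (@ksgn k (gtpowers V) 1) := @ksgn_lin k (gtpowers V) 1.
have dl : linear (@decat k V) := @decat_lin k V.
move: c; apply: word_ext => [||s].
- by apply: lin_comp; [exact: dl|exact: coder_lin].
- apply: lin_add; apply: lin_comp => //; apply: tmap_lin => //; exact: coder_lin.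
rewrite coderE decatE !(lin_splitsum _ _ dl).
rewrite (lin_splitsum _ _ (tmap_lin coder_lin il)) (lin_splitsum _ _ (tmap_lin sl coder_lin)).
under eq_splitsum => u z.
  rewrite (lin_splitsum _ _ dl).
  under eq_splitsum => v w do rewrite decatE splitsum_cat splitsum_map.
  rewrite splitsumD.
  over.
rewrite splitsumD addrC; congr (_ + _).
  under [RHS]eq_splitsum => y c.
    rewrite tmapE // ; last exact: coder_lin.
    rewrite coderE (lin_splitsum _ _ (tens_linl _)).
    under eq_splitsum => u v do rewrite (lin_splitsum _ _ (tens_linl _)).
    over.
  rewrite /= [RHS](splitsumA (fun u z c =>
     splitsum (fun v w => tens (word (sg u ++ b v :: w)) (word c)) z)).
  apply: eq_splitsum => u z.
  by rewrite -(splitsumA (fun v w c => tens (word (sg u ++ b v :: w)) (word c))) //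
    (splitsumA (fun v w c => tens (word (sg u ++ b v :: w)) (word c))).
under [RHS]eq_splitsum => u z.
  rewrite tmapE // ; last exact: coder_lin.
  rewrite [ksgn 1 _]ksgn_word coderE (lin_splitsum _ _ (tens_linr _)).
  under eq_splitsum => u' z' do rewrite (lin_splitsum _ _ (tens_linr _)).
  over.
rewrite /= -(splitsumA (fun u u' z =>
   splitsum (fun v w => tens (word (sg u)) (word (sg u' ++ b v :: w))) z)).
apply: eq_splitsum => u z.
rewrite /splitsum exchange_big; apply: eq_bigr => n _; apply: eq_bigr => m _ //.
Qed.

Hypothesis b_rel : forall s, \sum_(j < (size s).+1) \sum_(n < (size s - j).+1)
  b (insert 1 b j n s) = 0.

Lemma b_rel_split s : splitsum (fun u z =>
    splitsum (fun v w => b (sg u ++ b v :: w)) z) s = 0.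
Proof.
rewrite -[RHS](b_rel s); apply: eq_bigr => j _; rewrite /splitsum size_drop.
by apply: eq_bigr => n _; rewrite /insert drop_drop addnC.
Qed.

Lemma ksgn1_b v : ksgn 1 (b v) = - b (sg v).
Proof.
by rewrite (ksgn_multi 1 v b_multilin b_deg) mulr1 expr1 scaleN1r.
Qed.

Lemma ksgn11 (s : seq V) : sg (sg s) = s.
Proof.
rewrite -map_comp map_id_in // => x _ /=; rewrite -ksgnD -[RHS]ksgn0.
exact: ksgn_odd.
Qed.

Lemma splitsum3_cat (W : lmodType k) (G : seq V -> seq V -> seq V -> W) s y t :
  splitsum (fun u z => splitsum (G u) z) (s ++ y :: t) =
    splitsum (fun u z => splitsum (fun v r => G u v (r ++ y :: t)) z) s
  + splitsum (fun u r => splitsum (fun c w => G u (r ++ y :: c) w) t) s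
  + splitsum (fun c z => splitsum (fun v w => G (s ++ y :: c) v w) z) t.
Proof.
rewrite splitsum_cat; congr (_ + _); rewrite -splitsumD; apply: eq_splitsum => u z.
by rewrite splitsum_cat.
Qed.

Lemma coder_sq c : coder (coder c) = 0.
Proof.
move: c; apply: word_ext => [||s].
- by apply: lin_comp; exact: coder_lin.
- exact: lin_cst0.
rewrite coderE (lin_splitsum _ _ coder_lin).
under eq_splitsum => u z.
  rewrite (lin_splitsum _ _ coder_lin).
  under eq_splitsum => v w.
    rewrite coderE splitsum3_cat.
    over.
  rewrite !splitsumD.
  over.
rewrite !splitsumD /=.
set S1 := splitsum _ _; set S2 := splitsum _ _; set S3 := splitsum _ _.
have E2 : S2 = 0.
  pose G u r v c w := word (sg (sg u) ++ b (sg r ++ b v :: c) :: w) : TV.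
  transitivity (splitsum (fun u x => splitsum (fun q w =>
      splitsum (fun r y => splitsum (fun v c => G u r v c w) y) q) x) s).
    transitivity (splitsum (fun u x => splitsum (fun r z => splitsum (fun v y =>
        splitsum (fun c w => G u r v c w) y) z) x) s).
      rewrite -(splitsumA (fun u r z =>
        splitsum (fun v y => splitsum (fun c w => G u r v c w) y) z)).
      apply: eq_splitsum => u z; rewrite [RHS]splitsum_exchange.
      by apply: eq_splitsum => v y; rewrite splitsum_map.
    apply: eq_splitsum => u x.
    rewrite (splitsumA (fun r y w => splitsum (fun v c => G u r v c w) y)).
    apply: eq_splitsum => r z.
    by rewrite (splitsumA (fun v c w => G u r v c w)).
  rewrite /splitsum big1 // => n _; rewrite big1 // => m _.
  set q := take m _; set u := take n s; set w := drop m _.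
  have wl : linear (fun x => word (sg (sg u) ++ x :: w) : TV).
    by move=> a x y; rewrite word_multilin.
  transitivity (word (sg (sg u) ++ splitsum (fun r y =>
    splitsum (fun v c => b (sg r ++ b v :: c)) y) q :: w)); last first.
    by rewrite b_rel_split; exact: (lin0 wl).
  have E := lin_splitsum (fun r y => splitsum (fun v c => b (sg r ++ b v :: c)) y) q wl.
  rewrite /= in E; rewrite {}E; apply: eq_bigr => i _.
  exact: (esym (lin_splitsum (fun v c => b (sg (take i q) ++ b v :: c)) (drop i q) wl)).
have E13 : S1 = - S3.
  pose G u v c v' w := word (sg (sg u) ++ b (sg v) :: sg c ++ b v' :: w) : TV.
  transitivity (splitsum (fun u x => splitsum (fun v y =>
      splitsum (fun c z => splitsum (fun v' w => G u v c v' w) z) y) x) s); last first.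
    rewrite -splitsumN; apply: eq_splitsum => u x; rewrite -splitsumN.
    apply: eq_splitsum => v y; rewrite -splitsumN; apply: eq_splitsum => c z.
    rewrite -splitsumN; apply: eq_splitsum => v' w.
    rewrite map_cat /= ksgn1_b -catA /= /G.
    have wl : linear (fun x => word (sg (sg u) ++ x :: sg c ++ b v' :: w) : TV) by move=> a0 x0 y0; rewrite word_multilin.
    by rewrite [X in - X](linN wl) opprK.
  transitivity (splitsum (fun u x => splitsum (fun z' z => splitsum (fun v c =>
      splitsum (fun v' w => G u v c v' w) z) z') x) s); last first.
    apply: eq_splitsum => u x.
    exact: (splitsumA (fun v c z => splitsum (fun v' w => G u v c v' w) z)).
  rewrite -(splitsumA (fun u z' z =>
     splitsum (fun v c => splitsum (fun v' w => G u v c v' w) z) z')).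
  apply: eq_splitsum => u z.
  rewrite -[RHS]/(splitsum (fun u' z' => splitsum (fun v c =>
     splitsum (fun v' w => G u' v c v' w) z) z') u).
  under [RHS]eq_splitsum => u' z' do rewrite splitsum_exchange.
  rewrite [RHS]splitsum_exchange; apply: eq_splitsum => v w.
  rewrite splitsum_map; apply: eq_splitsum => u' z'.
  by rewrite splitsum_map.
by rewrite E2 E13 addr0 addNr.
Qed.

End Coderivation.

Section Bar.
Variables (k : comPzRingType) (A : ainf k).
Local Notation SA := (susp A).

(* - s m_n w^(x)n *)
Definition bar_op (s : seq SA) : SA := - sus (aop (ptens 1 (@des k A) s)).

Lemma ptens_multilin (V W : grmod k) (X : lmodType k) d (h : V -> W) (f : seq W -> X) :
  linear h -> multilinear f -> multilinear (fun s => f (ptens d h s)).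
Proof.
move=> hh hf s; elim: s f hf => [|z s IH] f hf t a x y /=.
  by rewrite (@ksgn_lin k V) hh; apply: (hf [::]).
rewrite !size_cat /=.
exact: (IH (fun t => f (_ :: t)) (multilin_consr _ hf)).
Qed.

Lemma des_lin : linear (@des k A). Proof. by []. Qed.

Lemma bar_op_multilin : multilinear bar_op.
Proof.
have h := ptens_multilin 1 des_lin (@aop_multilin k A).
by move=> s t a x y; rewrite /bar_op /sus h opprD scalerN.
Qed.

Lemma bar_op_deg : deg_multi (fun _ => 1) bar_op.
Proof.
move=> ps s hs; apply: homN.
have hP : homs [seq p + 1 | p <- ps] (ptens 1 (@des k A) s).
  elim: s ps hs => [|x s IH] [|p ps] //= [hx hs]; split; last exact: IH.
  exact: (@hom_ksgn k SA).
have sP : size (ptens 1 (@des k A) s) = size s by elim: (s) => //= x t ->.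
have := aop_deg hP; rewrite sP -(size_homs hs) big_map.
suff -> : \sum_(j <- ps) (j + 1) + (2 - (size ps)%:Z) = (\sum_(p <- ps) p + 1) + 1 :> int by [].
have -> : \sum_(j <- ps) (j + 1) = \sum_(p <- ps) p + (size ps)%:Z :> int.
  by elim: (ps) => [|p qs IH]; rewrite ?big_nil // !big_cons IH /=; lia.
by lia.
Qed.

Lemma ksgn_susp d (x : A) :
  @ksgn k A d x = (-1) ^+ `|d|%N *: (@ksgn k SA d x : A).
Proof.
move: x; apply: gr_ext => [||p x hx].
- exact: ksgn_lin.
- exact: (lin_scale _ (@ksgn_lin k SA d)).
have hx' : @hom k SA (p - 1) x by rewrite /hom /= subrK.
rewrite (ksgn_hom _ hx) [@ksgn k SA d x](ksgn_hom _ hx') scalerA -sgnD.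
by rewrite mulrBr mulr1 addrC subrK.
Qed.

Lemma ptens_cat (V W : grmod k) (h : V -> W) s t :
  ptens 1 h (s ++ t) = ptens 1 h (map (ksgn (size t)%:Z) s) ++ ptens 1 h t.
Proof.
elim: s => //= x s ->; congr (h _ :: _).
by rewrite size_cat size_map -ksgnD !mul1r PoszD.
Qed.

Lemma size_ptens (V W : grmod k) d (h : V -> W) s : size (ptens d h s) = size s.
Proof. by elim: s => //= x s ->. Qed.

Lemma map_ksgnD (V : grmod k) d e (s : seq V) :
  map (ksgn d) (map (ksgn e) s) = map (ksgn (d + e)) s.
Proof. by rewrite -map_comp; apply: eq_map => x /=; rewrite ksgnD. Qed.

Lemma ptens_map (d : int) (s : seq SA) :
  ptens 1 (@des k A) (map (ksgn d) s) = map (@ksgn k SA d) (ptens 1 (@des k A) s).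
Proof.
elim: s => //= x s ->; congr (_ :: _).
by rewrite /des size_map -!ksgnD addrC.
Qed.

Lemma map_ksgn_odd (V : grmod k) d e (s : seq V) : odd `|d|%N = odd `|e|%N ->
  map (ksgn d) s = map (ksgn e) s.
Proof. by move=> E; apply: eq_map => x; apply: ksgn_odd. Qed.

Lemma insert_cat (V : grmod k) d (m : seq V -> V) j n (s t r : seq V) :
  size s = j -> size t = n ->
  insert d m j n (s ++ t ++ r) = map (ksgn d) s ++ m t :: r.
Proof.
move=> <- <-; rewrite /insert take_size_cat // drop_size_cat // take_size_cat //.
by rewrite addnC -drop_drop !drop_size_cat.
Qed.

Lemma bar_op_insert u v w :
  bar_op ([seq ksgn 1 x | x <- u] ++ bar_op v :: w) =
  (-1) ^+ (size u * size v + size w) *: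
    aop (insert (2 - (size v)%:Z) (@aop k A) (size u) (size v)
           (ptens 1 (@des k A) (u ++ v ++ w))).
Proof.
have sm := @aop_multilin k A.
pose P := ptens 1 (@des k A).
have -> : insert (2 - (size v)%:Z) (@aop k A) (size u) (size v) (P (u ++ v ++ w)) =
  map (@ksgn k A (2 - (size v)%:Z)) (P (map (ksgn (size (v ++ w))%:Z) u)) ++
  aop (P (map (ksgn (size w)%:Z) v)) :: P w.
  rewrite /P !ptens_cat; apply: insert_cat; by rewrite size_ptens size_map.
have -> : map (@ksgn k A (2 - (size v)%:Z)) (P (map (ksgn (size (v ++ w))%:Z) u)) =
  map (fun x : A => (-1) ^+ size v *: x) (P (map (ksgn (size w)%:Z) u)).
  rewrite /P !ptens_map -!map_comp; apply: eq_map => x /=.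
  rewrite ksgn_susp; congr (_ *: _).
    by rewrite sgn_absz odd_abszD /= abszN absz_nat signr_odd.
  rewrite -ksgnD; apply: (@ksgn_odd k SA); rewrite !odd_abszD /= abszN !absz_nat size_cat oddD.
  by rewrite addbA addbb.
rewrite (multilin_scale_map _ _ _ sm) size_ptens size_map -exprM scalerA.
rewrite [(size v * size u)%N]mulnC exprD mulrAC -exprD addnn -mul2n exprM sqrrN !expr1n mul1r.
rewrite {1}/bar_op /sus ptens_cat -/P /=.
rewrite (_ : map _ (map _ u) = map (@ksgn k SA (size w)%:Z) u); last first.
  rewrite -map_comp; apply: eq_map => x /=; rewrite -(@ksgnD k SA).
  by apply: (@ksgn_odd k SA); rewrite odd_abszD !absz_nat /= addbT negbK.
rewrite -[P (_ :: w)]/(@ksgn k SA (1 * (size w)%:Z) (bar_op v) :: P w).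
rewrite (ksgn_multi _ _ bar_op_multilin bar_op_deg) mulr1 mul1r absz_nat /=.
rewrite /bar_op /sus -/P.
have sl := multilin_lin (P (map (ksgn (size w)%:Z) u)) (P w) sm.
rewrite [aop _](linZ sl) [X in - (_ *: X)](linN sl).
by rewrite scalerN opprK.
Qed.

Lemma bar_rel (s : seq SA) : \sum_(j < (size s).+1) \sum_(n < (size s - j).+1)
  bar_op (insert 1 bar_op j n s) = 0.
Proof.
rewrite -[RHS](aop_rel (ptens 1 (@des k A) s)) /msum size_ptens.
apply: eq_bigr => j _; apply: eq_bigr => n _.
have js : (j <= size s)%N by rewrite -ltnS ltn_ord.
have ns : (n <= size s - j)%N by rewrite -ltnS ltn_ord.
have e : s = take j s ++ take n (drop j s) ++ drop n (drop j s) by rewrite !cat_take_drop.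
have s1 : size (take j s) = j by rewrite size_takel.
have s2 : size (take n (drop j s)) = n by rewrite size_takel // size_drop.
have := bar_op_insert (take j s) (take n (drop j s)) (drop n (drop j s)).
rewrite s1 s2 -e !size_drop => <-.
by rewrite /insert addnC drop_drop.
Qed.

Definition bar : cgacdg k :=
  @Cgacdg k (gtpowers SA) (coder bar_op) (@decat k SA) (@tcounit k SA) (@taug k SA)
    (coder_lin bar_op_multilin) (@decat_lin k SA) (@tcounit_lin k SA) (@taug_lin k SA)
    (coder_deg bar_op_multilin bar_op_deg) (@decat_deg k SA) (@tcounit_deg k SA)
    (@taug_deg k SA) (@decat_assoc k SA) (@tcounit_l k SA) (@tcounit_r k SA)
    (coder_sq bar_op_multilin bar_op_deg bar_rel)
    (decat_coder bar_op_multilin) (tcounit_coder bar_op_multilin)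
    (@tcounit_aug k SA) (@decat_aug k SA) (@decat_cocomplete k SA).

End Bar.

(* The universal twisting cochain B A -> A; the bijection                     *)
(* CgaCdg(C, B A) = Tw(C, A) is composition with it.                          *)
Definition bar_tw (k : comPzRingType) (A : ainf k) : bar A -> A :=
  fun c => des (tproj c).

(* F = B f *)
Definition is_bar_hom (k : comPzRingType) (A A' : ainf k) (f : ainf_hom A A')
    (F : cgacdg_hom (bar A) (bar A')) : Prop :=
  forall s : seq (susp A), tproj (F (word s)) = sus (f (ptens 1 (@des k A) s)).

(* (Om, tau) corepresents A' |-> Tw(C, A') on Alg_[0,2]: Om is the cobar      *)
(* construction of C, and tau its universal twisting cochain.                 *)
Definition is_cobar (k : comPzRingType) (C : cgacdg k) (Om : cdga k) (tau : C -> Om) : Prop :=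
  is_tw tau /\
  forall (A' : cdga k) (tau' : C -> A'), is_tw tau' ->
    exists! g : cdga_hom Om A', forall c, g [:: tau c] = tau' c.

(* F corresponds to g in the adjunction bijection                             *)
(* Alg_[0,2](Om, A') = Tw(C, A') = CgaCdg(C, B A').                           *)
Definition is_adjunct (k : comPzRingType) (C : cgacdg k) (Om A' : cdga k) (tau : C -> Om)
    (g : cdga_hom Om A') (F : cgacdg_hom C (bar A')) : Prop :=
  forall c, bar_tw (F c) = g [:: tau c].

(* u : A -> Omega B A corresponds to the identity of Omega B A                *)
Definition is_unit (k : comPzRingType) (A : ainf k) (Om : cdga k) (tau : bar A -> Om)
    (u : ainf_hom A Om) : Prop :=
  exists F : cgacdg_hom (bar A) (bar Om),
    is_adjunct tau (cdga_id Om) F /\ is_bar_hom u F.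

Definition is_universal (k : comPzRingType) (A : ainf k) (U : cdga k)
    (u : ainf_hom A U) : Prop :=
  forall (A' : cdga k) (f : ainf_hom A A'),
    exists! g : cdga_hom U A', forall s, acomp g u s = f s.

(* Main.v *)
Require Import Defs.
From HB Require Import structures.
From mathcomp Require Import all_boot all_order all_algebra.
From mathcomp Require Import boolp zify.
Set Implicit Arguments.
Unset Strict Implicit.
Unset Printing Implicit Defensive.
Import Order.TTheory GRing.Theory Num.Theory.
Local Open Scope ring_scope.

(** For A-infinity algebras A and B, a family f_n of maps from the tensor
    powers of A to B and a map tau from B A to B determine each other by
    tau = f_n w^(x)n on words of length n.  Under this correspondence the
    morphisms A -> B are exactly the twisting cochains B A -> B ([is_twP]): on
    a word, the difference of the two sides of the morphism equation is the
    left-hand side of the twisting equation.  The universal property of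
    Omega B A, which is stated for twisting cochains B A -> A', therefore is a
    universal property for morphisms A -> A'; the universal twisting cochain
    corresponds to the universal morphism u, and composing u with a strict
    morphism g is applying g to the values of u ([acomp_strict]).

    That u is the unit means that the adjunct F : B A -> B Omega B A of the
    identity is B u.  The map F has to be constructed: it is the extension of
    the degree 0 family phi = s tau to a coalgebra map ([cofree]), and it
    commutes with the differentials because of the twisting equation
    ([coder_cofree]).

    All the sums over decompositions of a word are handled through the
    recursion [cofree_rec], which splits off a first block, and the
    coassociativity [splitsumA] of cutting a word.  The signs of the equations
    for A-infinity algebras and their morphisms are confined to [msum_ptens]
    and [csum_ptens], which turn them into unsigned sums over words in the
    suspension. *)

(** * Words *)

Section Words.
Variables (k : comPzRingType) (W : grmod k).
Local Notation TW := (tpowers W).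

(** The form in which the recursions on a first block are used: the cut with
    empty first block, where the tail does not get shorter, is compared
    separately. *)
Lemma splitsum_proper (T : Type) (X : lmodType k) (G H : seq T -> seq T -> X) s :
  G [::] s = H [::] s -> (forall u v, (size v < size s)%N -> G u v = H u v) ->
  splitsum G s = splitsum H s.
Proof.
move=> E0 E; apply: eq_bigr => -[[|n] /= ns] _; first by rewrite take0 drop0.
by apply: E; rewrite size_drop; lia.
Qed.

Lemma decat_wcons (x : W) (t : TW) :
  decat (wcons x t) = tens (word [::]) (wcons x t) + tmap (wcons x) idfun (decat t).
Proof.
have il : linear (@idfun TW) by [].
move: t; apply: word_ext => [||s].
- by apply: lin_comp; [exact: decat_lin|exact: wcons_lin].
- apply: lin_add; first by apply: lin_comp; [exact: tens_linr|exact: wcons_lin].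
  by apply: lin_comp; [exact: tmap_lin (wcons_lin x) il|exact: decat_lin].
rewrite wconsE !decatE splitsum_cons (lin_splitsum _ _ (tmap_lin (wcons_lin x) il)).
by congr (_ + _); apply: eq_splitsum => u v; rewrite tmapE ?wconsE //; exact: wcons_lin.
Qed.

Lemma tcounit_wcons (x : W) t : tcounit (wcons x t) = 0.
Proof.
move: t; apply: word_ext => [||s]; last by rewrite wconsE tcounitE.
- by apply: lin_comp; [exact: tcounit_lin|exact: wcons_lin].
- exact: lin_cst0.
Qed.

Lemma tproj_wcons (x : W) (t : TW) : tproj (wcons x t) = (tcounit t : k) *: x.
Proof.
move: t; apply: word_ext => [||s].
- by apply: lin_comp; [exact: tproj_lin|exact: wcons_lin].
- by move=> a y z; rewrite (@tcounit_lin k W) scalerDl scalerA.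
rewrite wconsE tcounitE /tproj wliftE; last exact: idfun_seq_multilin.
by case: s => [|y s]; rewrite /= ?scale1r ?scale0r.
Qed.

End Words.

(** * The coalgebra map with a given projection *)

Section CofreeExtension.
Variables (k : comPzRingType) (V W : grmod k) (phi : seq V -> W).
Hypotheses (phi_multilin : multilinear phi) (phi_deg : deg_multi (fun _ => 0) phi).
Hypothesis phi_nil : phi [::] = 0.

Local Notation TV := (tpowers V).
Local Notation TW := (tpowers W).

(** The sum of phi(b_1) (x) ... (x) phi(b_r) over the cuts of s into r
    consecutive blocks.  Empty blocks are allowed: they contribute 0, and a cut
    is then nothing but an iterated deconcatenation. *)
Fixpoint blocks (r : nat) (s : seq V) : TW :=
  if r is r'.+1 then
    @splitsum k V TW (fun u v => wcons (phi u) (blocks r' v)) s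
  else (nilp s)%:R *: word [::].

Definition cofree_word (s : seq V) : TW := \sum_(r < (size s).+1) blocks r s.
Definition cofree : gtpowers V -> gtpowers W := wlift cofree_word.

Lemma wcons_phi_nil t : wcons (phi [::]) t = 0 :> TW.
Proof. by rewrite phi_nil (lin0 (wcons_linl _)). Qed.

Lemma blocks_oversize r s : (size s < r)%N -> blocks r s = 0.
Proof.
elim: r s => // r IH s sr /=; rewrite /splitsum big1 // => -[[|n] /= ns] _.
  by rewrite take0 wcons_phi_nil.
rewrite IH ?(lin0 (wcons_lin _)) // size_drop; lia.
Qed.

Lemma blocks_multilin r : multilinear (blocks r).
Proof.
elim: r => [|r IH].
  by move=> [|z s] t a x y; rewrite /= !scale0r scaler0 addr0.
apply: (@splitsum_multilin k V TW (fun u v => wcons (phi u) (blocks r v))) => [v|u].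
  exact: (lin_multilin (wcons_linl _) phi_multilin).
exact: (lin_multilin (wcons_lin _) IH).
Qed.

Lemma cofree_word_multilin : multilinear cofree_word.
Proof.
move=> s t a x y; rewrite /cofree_word !size_cat scaler_sumr -big_split.
by apply: eq_bigr => r _; rewrite blocks_multilin.
Qed.

Lemma cofree_lin : linear cofree.
Proof. exact/wlift_lin/cofree_word_multilin. Qed.

(** Cutting into more blocks than there are letters leaves an empty block, so
    the bound on the number of blocks may be chosen freely. *)
Lemma cofreeE N s : (size s < N)%N -> cofree (word s) = \sum_(r < N) blocks r s.
Proof.
move=> sN; rewrite /cofree wliftE; last exact: cofree_word_multilin.
rewrite /cofree_word (big_ord_widen _ (fun r => blocks r s) sN).
rewrite [RHS](bigID (fun r : 'I_N => r < (size s).+1)%N) /= [X in _ + X]big1 ?addr0 //.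
by move=> r; rewrite ltnS -ltnNge; apply: blocks_oversize.
Qed.

(** The recursion that replaces the sum over all cuts.  It determines [cofree]
    on words by induction on the length, as the first block of a nonzero term
    is nonempty. *)
Lemma cofree_rec s : cofree (word s) = (nilp s)%:R *: word [::] +
  @splitsum k V TW (fun u v => wcons (phi u) (cofree (word v))) s.
Proof.
rewrite (@cofreeE (size s).+2) // big_ord_recl; congr (_ + _) => /=.
rewrite /splitsum exchange_big; apply: eq_bigr => n _ /=.
rewrite -(lin_sum (wcons_lin _)) -(@cofreeE (size s).+1) // ltnS size_drop.
exact: leq_subr.
Qed.

Lemma cofree_deg : deg_map 0 cofree.
Proof.
apply: deg_map_words; first exact: cofree_lin.
move=> ps s hs; rewrite addr0 (cofreeE (ltnSn _)); apply: hom_sum => -[r /= _] _.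
elim: r ps s hs => [|r IH] ps s hs /=.
  case: s ps hs => [|x s] [|p ps] //= hs; last by rewrite scale0r; exact: hom0.
  by rewrite scale1r; exact: (@hom_word k W [::] [::]).
apply: hom_sum => n _; rewrite -[ps](cat_take_drop n) big_cat /=.
apply: hom_wcons; last by apply: IH; exact: homs_drop.
by have := phi_deg (homs_take n hs); rewrite addr0.
Qed.

(** By induction on the length: deconcatenating phi(u) (x) t either leaves the
    left factor empty or puts phi(u) at the head of it, and the terms of the
    second kind recombine by [splitsumA]. *)
Lemma decat_cofree_word s : decat (cofree (word s)) =
  @splitsum k V (tensor TW TW) (fun u v => tens (cofree (word u)) (cofree (word v))) s.
Proof.
have il : linear (@idfun TW) by [].
have dl : linear (@decat k W) := @decat_lin k W.
elim: {s}_.+1 {-2}s (ltnSn (size s)) => // n IH s sn.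
rewrite cofree_rec (linD dl) (linZ dl) decatE splitsum_nil (lin_splitsum _ _ dl).
(* the left factor is empty, or it starts with phi(u1) *)
transitivity ((nilp s)%:R *: tens (word [::]) (word [::]) + (
    @splitsum k V (tensor TW TW) (fun u v => tens (word [::]) (wcons (phi u) (cofree (word v)))) s
  + @splitsum k V (tensor TW TW) (fun u w =>
      @splitsum k V (tensor TW TW) (fun u1 u2 =>
        tens (wcons (phi u1) (cofree (word u2))) (cofree (word w))) u) s)).
  congr (_ + _); rewrite splitsumA -splitsumD.
  apply: splitsum_proper => [|u v vs].
    rewrite wcons_phi_nil (lin0 dl) (lin0 (tens_linr _)) add0r /splitsum big1 // => i _.
    by rewrite wcons_phi_nil (lin0 (tens_linl _)).
  rewrite decat_wcons IH; last by lia.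
  congr (_ + _); rewrite (lin_splitsum _ _ (tmap_lin (wcons_lin _) il)).
  by apply: eq_splitsum => a b; rewrite tmapE //; exact: wcons_lin.
rewrite -(lin_splitsum _ _ (tens_linr _)) addrA -(linZ (tens_linr _)) -(linD (tens_linr _)).
rewrite -cofree_rec.
transitivity (@splitsum k V (tensor TW TW) (fun u v =>
   (nilp u)%:R *: tens (word [::]) (cofree (word v)) +
    @splitsum k V (tensor TW TW) (fun u1 u2 =>
        tens (wcons (phi u1) (cofree (word u2))) (cofree (word v))) u) s).
  rewrite splitsumD; congr (_ + _).
  rewrite /splitsum big_ord_recl take0 drop0 scale1r big1 ?addr0 // => i _.
  by case: (s) i => [[]//|x s' i]; rewrite scale0r.
apply: eq_splitsum => u v.
rewrite (cofree_rec u) (linD (tens_linl _)) (linZ (tens_linl _)); congr (_ + _).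
by rewrite (lin_splitsum _ _ (tens_linl _)).
Qed.

Lemma cofree_decat c : decat (cofree c) = tmap cofree cofree (decat c).
Proof.
have fl : linear (cofree : TV -> TW) := cofree_lin.
move: c; apply: word_ext => [||s].
- by apply: lin_comp; [exact: decat_lin|exact: cofree_lin].
- by apply: lin_comp; [exact: tmap_lin|exact: decat_lin].
rewrite decat_cofree_word decatE (lin_splitsum _ _ (tmap_lin fl fl)).
by apply: eq_splitsum => u v; rewrite tmapE.
Qed.

Lemma cofree_tcounit c : tcounit (cofree c) = tcounit c.
Proof.
move: c; apply: word_ext => [||s].
- by apply: lin_comp; [exact: tcounit_lin|exact: cofree_lin].
- exact: tcounit_lin.
have tl := @tcounit_lin k W.
rewrite cofree_rec (linD tl) (linZ tl) (lin_splitsum _ _ tl) /splitsum big1.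
  by rewrite addr0 !tcounitE [LHS]mulr1.
by move=> i _; exact: tcounit_wcons.
Qed.

Lemma cofree_taug a : cofree (taug V a) = taug W a.
Proof.
rewrite /taug (linZ cofree_lin) cofree_rec splitsum_nil wcons_phi_nil addr0.
by rewrite scale1r.
Qed.

Lemma tproj_cofree s : tproj (cofree (word s)) = phi s.
Proof.
have tl := @tproj_lin k W.
rewrite cofree_rec (linD tl) (linZ tl) (lin_splitsum _ _ tl).
rewrite {1}/tproj wliftE; last exact: idfun_seq_multilin.
rewrite scaler0 add0r /splitsum big_ord_recr big1 => [|n _]; rewrite /= tproj_wcons.
  by rewrite cofree_tcounit tcounitE take_size drop_size scale1r add0r.
rewrite cofree_tcounit tcounitE; case: n => n /= hn.
by rewrite /nilp size_drop subn_eq0 leqNgt hn scale0r.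
Qed.

Lemma phi_ksgn s : ksgn 1 (phi s) = phi (map (ksgn 1) s).
Proof. by rewrite (ksgn_multi 1 s phi_multilin phi_deg) mulr0 scale1r. Qed.

(** ** Compatibility with coderivations *)

Section Coder.
Variables (b : seq V -> V) (b' : seq W -> W).
Hypotheses (b_multilin : multilinear b) (b'_multilin : multilinear b').
(* the projection to W of the identity [coder_cofree], evaluated on a word *)
Hypothesis phi_b : forall s,
  @splitsum k V W (fun u z => @splitsum k V W (fun v w =>
     phi (map (ksgn 1) u ++ b v :: w)) z) s = wlift b' (cofree (word s)).

(** The part of the coderivation that applies b' to an initial segment. *)
Definition coder_head : TW -> TW :=
  wlift (@splitsum k W TW (fun v w => word (b' v :: w))).

Lemma coder_head_multilin :
  multilinear (@splitsum k W TW (fun v w => word (b' v :: w))).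
Proof.
apply: splitsum_multilin => [w|v].
  by move=> s t a x y; rewrite b'_multilin (multilin_cons _ (@word_multilin k W)).
exact: wcons_multilin.
Qed.

Lemma coder_head_lin : linear coder_head.
Proof. exact/wlift_lin/coder_head_multilin. Qed.

Lemma coder_wcons x t :
  coder b' (wcons x t) = coder_head (wcons x t) + wcons (ksgn 1 x) (coder b' t).
Proof.
have cl := coder_lin b'_multilin.
move: t; apply: word_ext => [||s].
- by apply: lin_comp; [exact: cl|exact: wcons_lin].
- apply: lin_add; first by apply: lin_comp; [exact: coder_head_lin|exact: wcons_lin].
  by apply: lin_comp; [exact: wcons_lin|exact: cl].
rewrite wconsE !coderE // splitsum_cons /coder_head wliftE; last exact: coder_head_multilin.
congr (_ + _); rewrite (lin_splitsum _ _ (wcons_lin _)).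
apply: eq_splitsum => u z; rewrite (lin_splitsum _ _ (wcons_lin _)).
by apply: eq_splitsum => v w; rewrite wconsE.
Qed.

Lemma coder_head_decat t :
  coder_head t = tlift (fun x y => wcons (wlift b' x) y) (decat t).
Proof.
have bl : bilin (fun x y : TW => wcons (wlift b' x) y).
  by apply: (bilin_comp2 (wcons_bilin _)) => //; exact: wlift_lin.
move: t; apply: word_ext => [||s].
- exact: coder_head_lin.
- by apply: lin_comp; [exact: tlift_lin|exact: decat_lin].
rewrite /coder_head wliftE; last exact: coder_head_multilin.
rewrite decatE (lin_splitsum _ _ (tlift_lin bl)); apply: eq_splitsum => u v.
by rewrite tliftE // wconsE wliftE.
Qed.

(** Both sides are determined by their projection to W, where they agree by
    [phi_b].  Concretely, induct on the length of the word.  If b' acts on an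
    initial segment of the sequence of blocks, [phi_b] with [decat_cofree_word]
    gives the terms in which the letter produced by b lies in the first block;
    if b' acts behind the first block, the induction hypothesis for the rest of
    the word gives the terms in which that letter lies behind the first block. *)
Lemma coder_cofree c : cofree (coder b c) = coder b' (cofree c).
Proof.
have fl : linear (cofree : TV -> TW) := cofree_lin.
have cl := coder_lin b'_multilin.
have bl : bilin (fun x y : TW => wcons (wlift b' x) y).
  by apply: (bilin_comp2 (wcons_bilin _)) => //; exact: wlift_lin.
move: c; apply: word_ext => [||s].
- by apply: lin_comp; [exact: cofree_lin|exact: coder_lin].
- by apply: lin_comp; [exact: cl|exact: cofree_lin].
elim: {s}_.+1 {-2}s (ltnSn (size s)) => // n IH s sn.
(* [phi_b] on the initial segment of blocks that b' swallows *)
have EL : coder_head (cofree (word s)) = @splitsum k V TW (fun u z =>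
    @splitsum k V TW (fun v w => @splitsum k V TW (fun w1 w2 =>
      wcons (phi (map (ksgn 1) u ++ b v :: w1)) (cofree (word w2))) w) z) s.
  rewrite coder_head_decat decat_cofree_word (lin_splitsum _ _ (tlift_lin bl)).
  transitivity (@splitsum k V TW (fun x w2 => @splitsum k V TW (fun u y =>
     @splitsum k V TW (fun v w1 => 
      wcons (phi (map (ksgn 1) u ++ b v :: w1)) (cofree (word w2))) y) x) s).
    apply: eq_splitsum => x w2; rewrite tliftE // -phi_b.
    rewrite (lin_splitsum _ _ (wcons_linl _)); apply: eq_splitsum => u y.
    by rewrite (lin_splitsum _ _ (wcons_linl _)).
  rewrite (splitsumA (fun u y w2 => @splitsum k V TW (fun v w1 => 
      wcons (phi (map (ksgn 1) u ++ b v :: w1)) (cofree (word w2))) y)).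
  apply: eq_splitsum => u z.
  exact: (splitsumA (fun v w1 w2 =>
    wcons (phi (map (ksgn 1) u ++ b v :: w1)) (cofree (word w2)))).
(* phi has degree 0, so the sign passes from phi(u) to the letters of u *)
have ER : coder b' (cofree (word s)) = coder_head (cofree (word s)) +
    @splitsum k V TW (fun u v => wcons (phi (map (ksgn 1) u)) (coder b' (cofree (word v)))) s.
  rewrite {1 2}cofree_rec (linD cl) (linZ cl) (linD coder_head_lin) (linZ coder_head_lin).
  rewrite -addrA; congr (_ *: _ + _).
    by rewrite coderE // splitsum_nil /coder_head wliftE //; exact: coder_head_multilin.
  rewrite (lin_splitsum _ _ cl) (lin_splitsum _ _ coder_head_lin) -splitsumD.
  by apply: eq_splitsum => u v; rewrite coder_wcons phi_ksgn.
rewrite {}ER {}EL coderE // (lin_splitsum _ _ fl).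
(* the first block of the word ends before the letter b(v) or contains it *)
transitivity (@splitsum k V TW (fun u z => @splitsum k V TW (fun v w =>
    @splitsum k V TW (fun a c => wcons (phi (map (ksgn 1) a))
      (cofree (word (map (ksgn 1) c ++ b v :: w)))) u
    + @splitsum k V TW (fun w1 w2 =>
      wcons (phi (map (ksgn 1) u ++ b v :: w1)) (cofree (word w2))) w) z) s).
  apply: eq_splitsum => u z; rewrite (lin_splitsum _ _ fl); apply: eq_splitsum => v w.
  rewrite cofree_rec splitsum_cat splitsum_map.
  by case: (map _ u) => [|? ?]; rewrite scale0r add0r.
under eq_splitsum => u z do rewrite splitsumD.
rewrite splitsumD addrC; congr (_ + _).
transitivity (@splitsum k V TW (fun a y => @splitsum k V TW (fun c z =>
    @splitsum k V TW (fun v w => wcons (phi (map (ksgn 1) a))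
      (cofree (word (map (ksgn 1) c ++ b v :: w)))) z) y) s).
  rewrite -[RHS](splitsumA (fun a c z => @splitsum k V TW (fun v w =>
    wcons (phi (map (ksgn 1) a)) (cofree (word (map (ksgn 1) c ++ b v :: w)))) z)).
  apply: eq_splitsum => u z; exact: splitsum_exchange.
apply: splitsum_proper => [|a y ys].
  rewrite /= wcons_phi_nil /splitsum big1 // => i _; rewrite big1 // => j _.
  exact: wcons_phi_nil.
rewrite -IH; last by lia.
rewrite coderE // (lin_splitsum _ _ fl) (lin_splitsum _ _ (wcons_lin _)).
apply: eq_splitsum => c z.
by rewrite (lin_splitsum _ _ fl) (lin_splitsum _ _ (wcons_lin _)).
Qed.

End Coder.
End CofreeExtension.

(** * The signs of the structure equations *)

Section ShiftInsert.
Variables (k : comPzRingType) (A : ainf k) (W : grmod k) (f : seq A -> W).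
Hypothesis f_multilin : multilinear f.
Local Notation SA := (susp A).
Local Notation P := (ptens 1 (@des k A)).

Lemma multilin_map_ksgn_susp d (s t : seq A) :
  f (map (@ksgn k A d) s ++ t) =
  (-1) ^+ (`|d| * size s)%N *: f (map (@ksgn k SA d) s ++ t).
Proof.
have -> : map (@ksgn k A d) s =
    map (fun x : A => (-1) ^+ `|d|%N *: x) (map (@ksgn k SA d) s).
  by rewrite -map_comp; apply: eq_map => x /=; rewrite ksgn_susp.
by rewrite (multilin_scale_map _ _ _ f_multilin) size_map exprM.
Qed.

(** The sign of the A-infinity relation is what is needed to move w^(x)p past
    the bar operation - s m_n w^(x)n: the suspended letters in front of it
    carry the Koszul sign of a map of degree 1, whatever n is. *)
Lemma ptens_bar_op_insert (u v w : seq SA) :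
  f (P (map (@ksgn k SA 1) u ++ bar_op v :: w)) =
  - ((-1) ^+ (size u * size v + size w) *:
     f (insert (2 - (size v)%:Z) (@aop k A) (size u) (size v) (P (u ++ v ++ w)))).
Proof.
rewrite !ptens_cat insert_cat ?size_ptens ?size_map //=.
rewrite multilin_map_ksgn_susp size_ptens size_map scalerA.
rewrite -[des _]/(@ksgn k SA (1 * (size w)%:Z) (bar_op v)).
rewrite (ksgn_multi _ _ (@bar_op_multilin k A) (@bar_op_deg k A)) mulr1 mul1r absz_nat.
have tl := multilin_lin (P (map (@ksgn k SA (size w).+1%:Z) (map (@ksgn k SA 1) u)))
  (P w) f_multilin.
rewrite [f _](linZ tl) /bar_op /sus (linN tl) scalerN; congr (- _).
rewrite !map_ksgnD !ptens_map !map_ksgnD size_cat.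
congr (_ *: f (_ ++ _)); last first.
  by apply: (@map_ksgn_odd k SA); rewrite !(odd_abszD, abszN, absz_nat, oddD) /=; case: (odd (size v)); case: (odd (size w)).
rewrite exprD mulrAC -exprD -[LHS]mul1r; congr (_ * _).
rewrite -signr_odd oddD !oddM odd_abszD abszN absz_nat /= andbC addbb //.
Qed.

Lemma msum_ptens (t : seq SA) :
  msum f (@aop k A) (P t) =
  - @splitsum k SA W (fun u z => @splitsum k SA W (fun v w =>
      f (P (map (@ksgn k SA 1) u ++ bar_op v :: w))) z) t.
Proof.
rewrite -splitsumN /msum /splitsum size_ptens; apply: eq_bigr => -[j /= jt] _.
rewrite -sumrN size_drop; apply: eq_bigr => -[n /= nt] _.
rewrite ptens_bar_op_insert opprK.
have jt' : (j <= size t)%N := jt.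
have nt' : (n <= size t - j)%N := nt.
have s1 : size (take j t) = j by rewrite size_takel.
have s2 : size (take n (drop j t)) = n by rewrite size_takel // size_drop.
by rewrite !cat_take_drop s1 s2 !size_drop.
Qed.
End ShiftInsert.

Section Compositions.
Variables (k : comPzRingType) (T : Type) (X : lmodType k).
Implicit Types (s : seq T) (H : seq (seq T) -> X).

(** The sums over all i_1, ..., i_r >= 1 of total size s in the morphism
    equation, put into the form of a recursion on the first block. *)
Fixpoint comps (r : nat) H s : X :=
  if r is r'.+1 then
    @splitsum k T X (fun u v => if nilp u then 0 else comps r' (fun bs => H (u :: bs)) v) s
  else if nilp s then H [::] else 0.

Lemma eq_comps r H H' s :
  (forall bs, size bs = r -> sumn (shape bs) = size s -> H bs = H' bs) ->
  comps r H s = comps r H' s.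
Proof.
elim: r H H' s => [|r IH] H H' s E /=.
  by case: s E => //= E; apply: E.
apply: eq_bigr => n _; case: ifP => // _; apply: IH => bs sbs sh.
apply: E => /=; first by rewrite sbs.
by rewrite sh -size_cat cat_take_drop.
Qed.

(** The range N of the parts only has to contain size s; leaving it free makes
    the induction on the number of parts possible, as the tail of s is shorter. *)
Lemma sum_compositions r N H s : (size s <= N)%N ->
  \sum_(i : r.-tuple 'I_N.+1 | all (leq 1) (map val i) && (sumn (map val i) == size s))
    H (reshape (map val i) s) = comps r H s.
Proof.
elim: r H s => [|r IH] H s sN.
  case: s sN => [|x s] _ /=.
    by rewrite (big_pred1 [tuple]) // => i; rewrite tuple0; apply/esym/eqP.
  by rewrite big_pred0 // => i; rewrite tuple0.
rewrite (reindex (fun p : 'I_N.+1 * r.-tuple 'I_N.+1 => cons_tuple p.1 p.2)) /=; last first.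
  exists (fun t : r.+1.-tuple 'I_N.+1 => (thead t, behead_tuple t)) => [[a t] _|t _].
    by rewrite theadE; congr (_, _); apply: val_inj.
  by rewrite [RHS]tuple_eta; apply: val_inj.
pose Q (a : 'I_N.+1) (t : r.-tuple 'I_N.+1) :=
  (0 < a)%N && all (leq 1) (map val t) && (a + sumn (map val t) == size s)%N.
rewrite -(pair_big_dep xpredT Q (fun a t => H (take a s :: reshape (map val t) (drop a s)))) /=.
rewrite /splitsum (@big_ord_widen _ _ _ (size s).+1 N.+1 (fun n => if nilp (take n s) then 0
   else comps r (fun bs => H (take n s :: bs)) (drop n s))) //.
rewrite [RHS]big_mkcond /=; apply: eq_bigr => -[a /= aN] _.
rewrite ltnS /Q /nilp /=; case: (leqP a (size s)) => [as_|sa]; last first.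
  by apply: big_pred0 => t; apply/negP => /andP[_ /eqP]; lia.
rewrite size_takel //; case: posnP => [->|a0] /=; first by rewrite big_pred0.
rewrite -(IH (fun bs => H (take a s :: bs))); last by rewrite size_drop; lia.
by apply: eq_bigl => t; rewrite size_drop; congr (_ && _); apply/eqP/eqP; move: (sumn _) => m; lia.
Qed.

End Compositions.

Section ShiftedFamily.
Variables (k : comPzRingType) (A B : ainf k) (f : seq A -> B).
Hypotheses (f_multilin : multilinear f) (f_deg : deg_multi (fun n => 1 - n%:Z) f).
Local Notation SA := (susp A).
Local Notation SB := (susp B).

(** s f_n w^(x)n *)
Definition shifted (t : seq SA) : SB := sus (f (ptens 1 (@des k A) t)).

Lemma shifted_multilin : multilinear shifted.
Proof. exact: (ptens_multilin 1 (@des_lin k A) f_multilin). Qed.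

Lemma homs_ptens_des ps (s : seq SA) : homs ps s ->
  homs [seq p + 1 | p <- ps] (ptens 1 (@des k A) s).
Proof.
elim: s ps => [|x s IH] [|p ps] //= [hx hs]; split; last exact: IH.
exact: (@hom_ksgn k SA).
Qed.

Lemma shifted_deg : deg_multi (fun _ => 0) shifted.
Proof.
move=> ps s hs; have := f_deg (homs_ptens_des hs).
rewrite size_ptens -(size_homs hs) big_map addr0 /hom /=.
suff -> : \sum_(j <- ps) (j + 1) + (1 - (size ps)%:Z) = \sum_(p <- ps) p + 1 :> int by [].
have -> : \sum_(j <- ps) (j + 1) = \sum_(p <- ps) p + (size ps)%:Z :> int.
  by elim: (ps) => [|p qs IH]; rewrite ?big_nil // !big_cons IH /=; lia.
by lia.
Qed.

End ShiftedFamily.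

Section CsumShift.
Variables (k : comPzRingType) (A B : ainf k) (X : grmod k).
Variables (f : seq A -> B).
Hypotheses (f_multilin : multilinear f) (f_deg : deg_multi (fun n => 1 - n%:Z) f).
Hypothesis f_nil : f [::] = 0.
Local Notation SA := (susp A).
Local Notation SB := (susp B).
Local Notation phi := (shifted f).
Local Notation PA := (ptens 1 (@des k A)).
Local Notation PB := (ptens 1 (@des k B)).

Lemma wlift_blocks (G : seq SB -> X) r t : multilinear G ->
  wlift G (blocks phi r t) = comps r (fun bs => G (map phi bs)) t.
Proof.
elim: r G t => [|r IH] G t hG /=.
  rewrite (linZ (wlift_lin hG)) wliftE //.
  by case: (nilp t); rewrite ?scale1r ?scale0r.
rewrite (lin_splitsum _ _ (wlift_lin hG)); apply: eq_splitsum => u v.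
case: u => [|x u] /=.
  by rewrite /shifted /= f_nil (lin0 (wcons_linl _)) (lin0 (wlift_lin hG)).
rewrite -(IH (fun s => G (phi (x :: u) :: s))); last exact: multilin_consr.
have hG' := multilin_consr (phi (x :: u)) hG.
move: (blocks phi r v); apply: word_ext => [||s].
- by apply: lin_comp; [exact: wlift_lin|exact: wcons_lin].
- exact: wlift_lin.
by rewrite wconsE !wliftE.
Qed.

Lemma csign_cons a (l : seq nat) :
  csign (a :: l) = a%:Z * \sum_(c <- l) (1 - c%:Z) + csign l.
Proof.
rewrite /csign big_ord_recl /= big_ord0 mulr0 add0r.
under eq_bigr => i _ do rewrite /bump leq0n add1n big_ord_recl /= mulrDr.
rewrite big_split /=; congr (_ + _).
by rewrite -mulr_suml mulrC (big_nth 0%N) big_mkord.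
Qed.

(** The sign s of the morphism equation is that of moving w^(x)p through
    f_(i_1) (x) ... (x) f_(i_r): splitting off the first block, the letters of
    which pass the later f_i, accounts for the first term of [csign_cons]. *)
Lemma comps_ptens (g : seq B -> X) r t : multilinear g ->
  comps r (fun bs => (-1) ^+ `|csign (shape bs)|%N *: g (btens f bs)) (PA t) =
  comps r (fun bs => g (PB (map phi bs))) t.
Proof.
elim: r g t => [|r IH] g t hg /=.
  rewrite /nilp size_ptens; case: ifP => // _.
  by rewrite /csign big_ord0 expr0 scale1r.
rewrite /splitsum size_ptens; apply: eq_bigr => -[n /= nt] _.
have {}nt : (n <= size t)%N by [].
have -> : take n (PA t) = PA (map (@ksgn k SA (size t - n)%N) (take n t)).
  rewrite -{1}(cat_take_drop n t) ptens_cat take_size_cat; last first.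
    by rewrite size_ptens size_map size_takel //.
  by rewrite size_drop.
have -> : drop n (PA t) = PA (drop n t).
  rewrite -{1}(cat_take_drop n t) ptens_cat drop_size_cat //.
  by rewrite size_ptens size_map size_takel //.
set u := take n t; set v := drop n t.
have -> : (size t - n)%N = size v by rewrite size_drop.
rewrite {1}/nilp size_ptens size_map -/(nilp u); case: ifP => // _.
(* e is the total degree of the maps applied to the later blocks *)
pose e : int := r%:Z - (size v)%:Z.
pose y : B := f (map (@ksgn k A e) (PA (map (@ksgn k SA (size v)) u))).
pose sg : k := (-1) ^+ `|((size u)%:Z * e)%R|%N.
transitivity (comps r (fun bs => (-1) ^+ `|csign (shape bs)|%N *:
    (sg *: g (y :: btens f bs))) (PA v)).
  apply: eq_comps => bs sbs sh.
  have esum : \sum_(c <- shape bs) (1 - c%:Z) = e.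
    have {}sh : sumn (shape bs) = size v by rewrite sh size_ptens.
    rewrite /e -sbs -sh.
    by elim: (bs) => [|b l IHl]; rewrite ?big_nil //= big_cons IHl; lia.
  rewrite /= csign_cons esum sgnD scalerA mulrC.
  by congr (_ *: g (_ :: _)); rewrite /y -esum /shape big_map.
rewrite (IH (fun s => sg *: g (y :: s))); last first.
  by move=> s1 s2 a x z; rewrite (multilin_consr y hg) scalerDr !scalerA mulrC.
apply: eq_comps => bs sbs sh /=.
have gl := multilin_cons (PB (map phi bs)) hg.
rewrite -(linZ gl); congr (g (_ :: _)).
rewrite /y -[map _ (PA _)]cats0 (multilin_map_ksgn_susp f_multilin) cats0.
rewrite size_ptens size_map scalerA -ptens_map map_ksgnD.
rewrite /des (ksgn_multi _ _ (shifted_multilin f_multilin) (shifted_deg f_deg)) mulr0 expr0 scale1r.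
rewrite size_map sbs mul1r subrK /sg abszM absz_nat [(size u * _)%N]mulnC.
by rewrite -expr2 sqrr_sign scale1r.
Qed.

Lemma csum_ptens (g : seq B -> X) t : multilinear g ->
  csum g f (PA t) = wlift (fun s => g (PB s)) (cofree phi (word t)).
Proof.
move=> hg; have hP := ptens_multilin 1 (@des_lin k B) hg.
rewrite (@cofreeE _ _ _ _ _ _ (size t).+1) //; last first.
- exact: (shifted_multilin f_multilin).
rewrite (lin_sum (wlift_lin hP)) /csum size_ptens; apply: eq_bigr => r _.
rewrite wlift_blocks // -comps_ptens // -(@sum_compositions _ _ _ _ (size t)) ?size_ptens //.
apply: eq_bigr => i /andP[_ /eqP isum].
by rewrite reshapeKl // isum size_ptens.
Qed.

End CsumShift.

(** * Twisting cochains on the bar construction *)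

(** Read as a map of words in the suspension, w^(x)n multiplies each letter by a
    sign that depends on its degree and its position only.  This is how words in
    A are written as w^(x)n of words in the suspension. *)
Lemma ptens_desK (k : comPzRingType) (A : ainf k) :
  involutive (fun s : seq (susp A) => ptens 1 (@des k A) s : seq (susp A)).
Proof.
elim=> //= x s IH; congr (_ :: _) => //.
rewrite /des size_ptens -(@ksgnD k (susp A)) -[RHS](@ksgn0 k (susp A)).
by apply: (@ksgn_odd k (susp A)); rewrite odd_abszD addbb.
Qed.

Lemma word_ptens_multilin (k : comPzRingType) (A : ainf k) :
  multilinear (fun s : seq A => word (ptens 1 (@des k A) (s : seq (susp A)) : seq (susp A))).
Proof.
exact: (ptens_multilin 1 (@des_lin k A) (@word_multilin k A)).
Qed.

Section SuspendedDegrees.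
Variables (k : comPzRingType) (A : ainf k).
Local Notation SA := (susp A).

Lemma homs_susp ps (s : seq A) : homs ps s -> @homs k SA [seq p - 1 | p <- ps] s.
Proof.
elim: s ps => [|x s IH] [|p ps] //= [hx hs]; split; last exact: IH.
exact: (etrans (congr1 (fun q => gpr q x) (subrK 1 p)) hx).
Qed.

Lemma homs_ptens_susp ps (s : seq SA) : homs ps s -> @homs k SA ps (ptens 1 (@des k A) s).
Proof.
elim: s ps => [|x s IH] [|p ps] //= [hx hs]; split; last exact: IH.
exact: (@hom_ksgn k SA).
Qed.

End SuspendedDegrees.

Lemma itcomul_lin (k : comPzRingType) (C : lmodType k) (D : C -> tensor C C) n :
  linear D -> linear (itcomul D n).
Proof.
move=> Dl; elim: n => [|n IH] /=; first exact/multilin_cons/word_multilin.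
apply: lin_comp => //.
exact/tlift_lin/(bilin_comp2 (wcons_bilin _) (@lin_id _ _) IH).
Qed.

Definition is_ainf_hom (k : comPzRingType) (A B : ainf k) (f : seq A -> B) : Prop :=
  [/\ multilinear f, deg_multi (fun n => 1 - n%:Z) f, f [::] = 0
    & forall s, msum f (@aop k A) s = csum (@aop k B) f s].

Section TwistingCochains.
Variables (k : comPzRingType) (A B : ainf k) (f : seq A -> B) (tau : bar A -> B).
Hypothesis tau_lin : linear tau.
Local Notation SA := (susp A).
Local Notation SB := (susp B).
Local Notation PA := (ptens 1 (@des k A)).
Local Notation PB := (ptens 1 (@des k B)).
Hypothesis f_tau : forall t : seq SA, f (PA t) = tau (word t).
Local Notation phi := (shifted f).

(** The left-hand side of the twisting equation: the terms with m_n are gathered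
    in m applied to the coalgebra map that extends s tau. *)
Definition tw_defect (c : bar A) : B :=
  wlift (fun s => aop (PB s)) (cofree phi c) + tau (cd c).

Lemma family_of_cochain s : f s = tau (word (PA (s : seq SA) : seq SA)).
Proof. by rewrite -f_tau (@ptens_desK k A). Qed.

Lemma family_multilin : multilinear f.
Proof.
move=> s t a x y; rewrite !family_of_cochain -tau_lin; congr tau.
exact: word_ptens_multilin.
Qed.

Lemma family_deg : deg_map 1 tau -> deg_multi (fun n => 1 - n%:Z) f.
Proof.
move=> dt ps s hs; rewrite family_of_cochain.
have := dt _ _ (hom_word (homs_ptens_susp (homs_susp hs))).
rewrite big_map -(size_homs hs).
suff -> : \sum_(p <- ps) p + (1 - (size ps)%:Z) = \sum_(p <- ps) (p - 1) + 1 :> int by [].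
have -> : \sum_(p <- ps) p = \sum_(p <- ps) (p - 1) + (size ps)%:Z :> int.
  by elim: (ps) => [|p qs IH]; rewrite ?big_nil // !big_cons IH /=; lia.
by lia.
Qed.

Lemma cochain_deg : deg_multi (fun n => 1 - n%:Z) f -> deg_map 1 tau.
Proof.
move=> df; apply: deg_map_words => // ps s hs; rewrite -f_tau.
have := shifted_deg df hs; rewrite addr0; exact.
Qed.

(** Since s tau has degree 0, the Koszul signs of tau^(x)n are those of w^(x)n. *)
Lemma wlift_ptens_tau (m : seq B -> B) (x : tpowers (bar A)) :
  multilinear m -> deg_map 1 tau ->
  wlift (fun l => m (ptens 1 tau l)) x =
  wlift (fun s => m (PB s)) (wlift (fun l => word (map (fun c => sus (tau c)) l)) x).
Proof.
move=> hm dt.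
have hw : multilinear (fun l : seq (bar A) => word (map (fun c => sus (tau c)) l)).
  by apply: multilin_map => //; exact: word_multilin.
have hP := ptens_multilin 1 (@des_lin k B) hm.
move: x; apply: word_ext => [||l].
- by apply: wlift_lin; exact: ptens_multilin.
- by apply: lin_comp; exact: wlift_lin.
rewrite !wliftE //; last exact: ptens_multilin.
congr m; elim: l => //= c l ->; congr (_ :: _).
have dt' : @deg_map k (bar A) SB 0 tau by move=> p v hv; have := dt p v hv; rewrite addr0.
rewrite size_map /des; have := @ksgn_deg k (bar A) SB 0 (1 * (size l)%:Z) _ tau_lin dt' c.
by rewrite mulr0 expr0 scale1r => ->.
Qed.

(** Applying s tau to the factors of an iterated comultiplication cuts the word
    into blocks; the n-fold iterate has n+1 factors. *)
Lemma word_tau_itcomul n (s : seq SA) :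
  wlift (fun l => word (map (fun c => sus (tau c)) l)) (itcomul (@cdelta k (bar A)) n (word s)) =
  blocks phi n.+1 s.
Proof.
have hw : multilinear (fun l : seq (bar A) => word (map (fun c => sus (tau c)) l)).
  by apply: multilin_map => //; exact: word_multilin.
have itl m := @itcomul_lin k _ _ m (@cdelta_lin k (bar A)).
elim: n s => [|n IH] s.
  rewrite /= wliftE //= -[sus _]f_tau /splitsum big_ord_recr big1 => [|i _] /=.
    by rewrite take_size drop_size scale1r add0r wconsE.
  case: i => i /= hi; rewrite /nilp size_drop subn_eq0 leqNgt hi scale0r.
  exact: (lin0 (wcons_lin _)).
have bl : bilin (fun x y => wcons x (itcomul (@cdelta k (bar A)) n y)).
  exact: (bilin_comp2 (wcons_bilin _) (@lin_id _ _) (itl n)).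
rewrite [itcomul _ _ _]/= decatE (lin_splitsum _ _ (tlift_lin bl)).
rewrite (lin_splitsum _ _ (wlift_lin hw)); apply: eq_splitsum => u v.
rewrite tliftE // -[RHS]/(wcons (phi u) (blocks phi n.+1 v)) -IH.
move: (itcomul _ _ _); apply: word_ext => [||l].
- by apply: lin_comp; [exact: wlift_lin|exact: wcons_lin].
- by apply: lin_comp; [exact: wcons_lin|exact: wlift_lin].
by rewrite wconsE !wliftE // wconsE /= /shifted f_tau.
Qed.

Lemma tw_defect_lin : linear tw_defect.
Proof.
apply: lin_add; last by apply: lin_comp => //; exact: cd_lin.
apply: lin_comp; last exact: (cofree_lin (shifted_multilin family_multilin)).
exact/wlift_lin/ptens_multilin/aop_multilin/des_lin.
Qed.

(** Cuts of a word of length p into more than p blocks contribute 0, so on such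
    a word N = p + 2 serves: it also makes room for the terms with n = 0 and
    n = 1, which stand outside of the sum.  Both sides are linear in c. *)
Lemma tw_eq_defect : deg_map 1 tau -> tau (word [::]) = 0 ->
  forall c : bar A, exists N, forall M, (N <= M)%N ->
    (ceta c : k) *: aop ([::] : seq B) + (aop [:: tau c] + tau (cd c))
    + \sum_(2 <= n < M)
        wlift (fun s => aop (ptens 1 tau s)) (itcomul (@cdelta k (bar A)) n.-1 c)
    = tw_defect c.
Proof.
move=> dt t0 c.
have hm := @aop_multilin k B.
have hP := ptens_multilin 1 (@des_lin k B) hm.
have itl m := @itcomul_lin k _ _ m (@cdelta_lin k (bar A)).
pose E M (c : bar A) := (ceta c : k) *: aop ([::] : seq B) + (aop [:: tau c] + tau (cd c))
    + \sum_(2 <= n < M)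
        wlift (fun s => aop (ptens 1 tau s)) (itcomul (@cdelta k (bar A)) n.-1 c).
have El M : linear (E M).
  apply: lin_add; first apply: lin_add.
  - by move=> a x y; rewrite (@ceta_lin k (bar A)) scalerDl scalerA.
  - apply: lin_add; first by apply: (lin_comp (multilin_cons [::] hm)).
    by apply: lin_comp => //; exact: cd_lin.
  apply: lin_bigsum => n _; apply: lin_comp => //.
  by apply/wlift_lin/ptens_multilin.
have Ql := tw_defect_lin.
suff [N h] : exists N, forall M, (N <= M)%N -> E M c = tw_defect c by exists N.
move: c; apply: pres_ind => [|u v [n hn] [m hm']|a u [n hn]|s].
- by exists 0%N => M _; rewrite (lin0 (El M)) (lin0 Ql).
- exists (maxn n m) => M; rewrite geq_max => /andP[nM mM].
  by rewrite (linD (El M)) (linD Ql) hn ?hm'.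
- by exists n => M nM; rewrite (linZ (El M)) (linZ Ql) hn.
exists (size s).+2 => M sM; rewrite -/(word s).
rewrite /tw_defect (@cofreeE _ _ _ _ (shifted_multilin family_multilin) _ M); first last.
- exact: ltnW.
- exact: (etrans (f_tau [::])).
rewrite (lin_sum (wlift_lin hP)) -(big_mkord xpredT (fun n => wlift _ (blocks phi n s))).
rewrite (big_ltn (_ : 0 < M)%N) ?(big_ltn (_ : 1 < M)%N) ?(leq_trans _ sM) //.
rewrite /E -!addrA; congr (_ + _).
  by rewrite (linZ (wlift_lin hP)) wliftE //= tcounitE.
rewrite addrCA [RHS]addrA [RHS]addrC; congr (_ + _); congr (_ + _).
  rewrite -word_tau_itcomul -wlift_ptens_tau // wliftE; last exact: ptens_multilin.
  by rewrite /= [ksgn _ _]ksgn0.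
apply: eq_big_nat => n /andP[n2 _].
by rewrite wlift_ptens_tau // word_tau_itcomul prednK // ltnW.
Qed.

(** The left-hand side of the morphism equation becomes - tau d, as the bar
    differential is built from - s m_n w^(x)n, and the right-hand side becomes the
    terms of the twisting equation with m. *)
Lemma msum_csum_defect (t : seq SA) : deg_multi (fun n => 1 - n%:Z) f -> f [::] = 0 ->
  csum (@aop k B) f (PA t) - msum f (@aop k A) (PA t) = tw_defect (word t).
Proof.
move=> fd f0; have fm := family_multilin.
rewrite (csum_ptens fm fd f0) //; last exact: aop_multilin.
rewrite (msum_ptens fm) opprK; congr (_ + _).
rewrite [cd _](coderE (@bar_op_multilin k A)) (lin_splitsum _ _ tau_lin).
apply: eq_splitsum => u z; rewrite (lin_splitsum _ _ tau_lin).
by apply: eq_splitsum => v w; rewrite f_tau.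
Qed.

(** Words span the bar construction, and the defect on the word of t is the
    defect of the morphism equation on w^(x)p t by [msum_csum_defect]. *)
Lemma is_twP : is_tw tau <-> is_ainf_hom f.
Proof.
have fm := family_multilin.
have tau1 : tau (ceps (bar A) (1 : k)) = tau (word [::]) by rewrite /= /taug scale1r.
split=> [[_ dt t0 te]|[_ fd f0 fr]].
  have f0 : f [::] = 0 by rewrite -[RHS](t0 1) tau1 -f_tau.
  have fd := family_deg dt.
  split=> // s; rewrite -[s](@ptens_desK k A); apply/esym/subr0_eq.
  rewrite msum_csum_defect //.
  have [N hN] := te (word (PA (s : seq SA) : seq SA)).
  have t0' : tau (word [::]) = 0 by rewrite -tau1.
  have [N' hN'] := tw_eq_defect dt t0' (word (PA (s : seq SA) : seq SA)).
  by rewrite -(hN' (maxn N N')) ?leq_maxr // hN // leq_maxl.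
have dt := cochain_deg fd.
have t0 : tau (word [::]) = 0 by rewrite -f_tau.
split=> // [a|c]; first by rewrite /= /taug (linZ tau_lin) t0 scaler0.
have [N hN] := tw_eq_defect dt t0 c; exists N => M /hN ->.
move: c {hN}; apply: word_ext => [||s]; [exact: tw_defect_lin|exact: lin_cst0|].
by rewrite -msum_csum_defect // fr subrr.
Qed.

(** The twisting equation on words is the hypothesis of [coder_cofree]. *)
Lemma cofree_bar_coder : is_tw tau ->
  forall c, cofree phi (coder (@bar_op k A) c) = coder (@bar_op k B) (cofree phi c).
Proof.
move=> /is_twP[fm fd f0 fr].
apply: coder_cofree; [exact: shifted_multilin|exact: shifted_deg|exact: f0| | |].
- exact: bar_op_multilin.
- exact: bar_op_multilin.
move=> s; apply/eqP; rewrite -subr_eq0.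
have hP := ptens_multilin 1 (@des_lin k B) (@aop_multilin k B).
have -> : wlift (@bar_op k B) (cofree phi (word s)) =
    - wlift (fun s => aop (PB s)) (cofree phi (word s)) :> B.
  move: (cofree _ _); apply: word_ext => [||l].
  - exact: (wlift_lin (@bar_op_multilin k B)).
  - by apply: lin_opp; exact: wlift_lin.
  by rewrite !wliftE //; exact: bar_op_multilin.
rewrite opprK -(csum_ptens fm fd f0); last exact: aop_multilin.
by rewrite -fr (msum_ptens fm) subrr.
Qed.

End TwistingCochains.

Lemma ainf_hom_ext (k : comPzRingType) (A B : ainf k) (f g : ainf_hom A B) :
  (forall s, f s = g s) -> f = g.
Proof.
case: f g => [f fm fd f0 fr] [g gm gd g0 gr] /= /funext E; subst g.
by congr AinfHom; apply: Prop_irrelevance.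
Qed.

Lemma ptens_des_surj (k : comPzRingType) (A : ainf k) (s : seq A) :
  exists t : seq (susp A), s = ptens 1 (@des k A) t.
Proof. by exists (ptens 1 (@des k A) (s : seq (susp A))); rewrite (@ptens_desK k A). Qed.

(** * Morphisms from twisting cochains, and conversely *)

Section Correspondence.
Variables (k : comPzRingType) (A : ainf k).
Local Notation SA := (susp A).
Local Notation PA := (ptens 1 (@des k A)).

Definition tw_family (B : ainf k) (tau : bar A -> B) (s : seq A) : B :=
  tau (word (PA (s : seq SA) : seq SA)).

Lemma tw_familyE (B : ainf k) (tau : bar A -> B) t : tw_family tau (PA t) = tau (word t).
Proof. by rewrite /tw_family (@ptens_desK k A). Qed.

Lemma tw_family_hom (B : ainf k) (tau : bar A -> B) : is_tw tau ->
  is_ainf_hom (tw_family tau).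
Proof. by move=> ht; apply/(is_twP (tw_lin ht) (tw_familyE tau)). Qed.

Lemma tw_ainf_hom (B : ainf k) (tau : bar A -> B) : is_tw tau ->
  exists u : ainf_hom A B, forall t : seq SA, u (PA t) = tau (word t).
Proof.
move=> /tw_family_hom[fm fd f0 fr].
by exists (AinfHom fm fd f0 fr) => t; exact: tw_familyE.
Qed.

(** The bijection between twisting cochains on B A with values in an algebra and
    morphisms from B A to its bar construction, in the direction that needs a
    construction. *)
Lemma tw_bar_hom (B : ainf k) (tau : bar A -> B) : is_tw tau ->
  exists F : cgacdg_hom (bar A) (bar B), forall c, bar_tw (F c) = tau c.
Proof.
move=> ht; have [fm fd f0 fr] := tw_family_hom ht.
have pm := shifted_multilin fm; have pd := shifted_deg fd.
have p0 : shifted (tw_family tau) [::] = 0 := f0.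
exists (@CgacdgHom k (bar A) (bar B) (cofree (shifted (tw_family tau)))
  (cofree_lin pm) (cofree_deg pm pd p0)
  (cofree_bar_coder (tw_lin ht) (tw_familyE tau) ht)
  (cofree_decat pm p0) (cofree_tcounit pm p0) (cofree_taug pm p0)) => /= c.
move: c; apply: word_ext => [||s].
- by apply: lin_comp; [exact: tproj_lin|exact: cofree_lin].
- exact: tw_lin ht.
by rewrite /bar_tw tproj_cofree //; exact: tw_familyE.
Qed.

Lemma ainf_hom_tw (B : ainf k) (f : ainf_hom A B) :
  exists2 tau : bar A -> B, is_tw tau & forall t : seq SA, f (PA t) = tau (word t).
Proof.
have sm := shifted_multilin (@afun_multilin _ _ _ f).
have E (t : seq SA) : f (PA t) = wlift (shifted f) (word t) by rewrite wliftE.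
exists (wlift (shifted f)) => //; apply/(is_twP (wlift_lin sm) E).
by split; [exact: afun_multilin|exact: afun_deg|exact: afun_nil|exact: afun_rel].
Qed.

(** A strict morphism has the only component g_1, so it sees of the coalgebra
    map [cofree] only its projection, which is s u. *)
Lemma acomp_strict (C D : cdga k) (g : cdga_hom C D) (u : ainf_hom A C) t :
  acomp g u (PA t) = g [:: u (PA t)].
Proof.
have um := @afun_multilin _ _ _ u; have gm := @afun_multilin _ _ _ g.
have gl := multilin_cons [::] gm; have g0 := @afun_nil _ _ _ g.
rewrite /acomp (csum_ptens um (@afun_deg _ _ _ u)) //; last exact: afun_nil.
rewrite -[u (PA t)](tproj_cofree (shifted_multilin um)); last exact: afun_nil.
move: (cofree _ _); apply: word_ext => [||s].
- exact/wlift_lin/ptens_multilin.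
- by apply: (lin_comp gl); exact: tproj_lin.
rewrite wliftE; last exact: ptens_multilin.
rewrite /tproj wliftE; last exact: idfun_seq_multilin.
case: s => [|x [|y s]] /=; first by rewrite g0 (lin0 gl).
  by rewrite /des [ksgn _ _]ksgn0.
by rewrite cdga_afunP // (lin0 gl).
Qed.

End Correspondence.

Theorem mainTheorem6 (k : comPzRingType) (A : ainf k)
  (Om : cdga k) (tau : bar A -> Om) (cobarOm : is_cobar tau) :
  exists u : ainf_hom A Om, unique (is_unit tau) u /\ is_universal u.
Proof.
have [tw_tau corep] := cobarOm.
have [u u_tau] := tw_ainf_hom tw_tau; have [F F_tau] := tw_bar_hom tw_tau.
exists u; split; last first.
  move=> A' f; have [tau' tw_tau' f_tau'] := ainf_hom_tw f.
  (* factoring f through u is factoring its twisting cochain through tau *)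
  have equiv (g : cdga_hom Om A') :
      (forall c, g [:: tau c] = tau' c) <-> (forall s, acomp g u s = f s).
    split=> [gE s|gE].
      by have [t ->] := ptens_des_surj s; rewrite acomp_strict u_tau gE f_tau'.
    apply: word_ext => [||t].
    - exact: (lin_comp (multilin_cons [::] (@afun_multilin _ _ _ g)) (tw_lin tw_tau)).
    - exact: tw_lin tw_tau'.
    by rewrite -u_tau -acomp_strict gE f_tau'.
  have [g [gE g_uniq]] := corep A' tau' tw_tau'.
  by exists g; split=> [|g' /equiv]; [apply/equiv|exact: g_uniq].
split; first by exists F; split=> // s; rewrite u_tau; exact: F_tau.
move=> u' [F' [F'_tau u'F']]; apply: ainf_hom_ext => s.
have [t ->] := ptens_des_surj s; rewrite u_tau.
exact: etrans (esym (F'_tau _)) (u'F' _).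
Qed.
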